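(* Let $p_1,p_2,p_3:[0,\delta]^3\to\mathbb R$ be smooth functions satisfying $p_1(x)<p_2(x)<p_3(x)$ and $\sum_{i=1}^3p_i(x)=\sum_{i=1}^3p_i^2(x)=1$ for all $x\in[0,\delta]^3$. Then, for any choice of one function $\alpha\in\{c_{11},c_{22}\}$ (prescribed positive), one function $\beta\in\{c_{33},\kappa_2{}^3\}$ (prescribed positive if it is $c_{33}$), and one function $\gamma\in\{\kappa_1{}^2,\kappa_1{}^3\}$, each freely prescribed as a smooth function $[0,\delta]^3\to\mathbb R$, there exist smooth functions $\epsilon,\zeta,\eta:[0,\delta]^3\to\mathbb R$ such that $$\{\alpha,\beta,\gamma,\epsilon,\zeta,\eta\}=\{c_{11},c_{22},c_{33},\kappa_1{}^2,\kappa_1{}^3,\kappa_2{}^3\}$$ and such that $(p_i,c_{ij})$ is a vacuum initial data set on the singularity (as defined in the context), where $c_{12},c_{13},c_{23}$ are uniquely determined by the values of $\kappa_1{}^2,\kappa_1{}^3,\kappa_2{}^3$. Moreover, the functions $\epsilon,\zeta,\eta$ are unique up to a choice of three functions of two variables.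
   Context: Smooth functions $c_{ij},p_i:[0,\delta]^3\to\mathbb R$ ($i,j=1,2,3$) form a vacuum initial data set on the singularity if, for all $x\in[0,\delta]^3$: (1) $c_{ii}(x)>0$ and $c_{ij}(x)=c_{ji}(x)$; (2) $p_1(x)<p_2(x)<p_3(x)$ and $\sum_ip_i(x)=\sum_ip_i^2(x)=1$; (3) for $i=1,2,3$, $$\sum_{l=1}^3\Big[\frac{\partial_ic_{ll}}{c_{ll}}(p_l-p_i)+2\partial_l\kappa_i{}^l+\mathbf 1_{\{l>i\}}\frac{\partial_l(c_{11}c_{22}c_{33})}{c_{11}c_{22}c_{33}}\kappa_i{}^l\Big]=0,$$ where $\kappa_i{}^i:=-p_i$ (no summation), $\kappa_i{}^l=0$ if $l<i$, and $$\kappa_1{}^2:=(p_1-p_2)\frac{c_{12}}{c_{22}},\quad \kappa_2{}^3:=(p_2-p_3)\frac{c_{23}}{c_{33}},\quad \kappa_1{}^3:=(p_2-p_1)\frac{c_{12}c_{23}}{c_{22}c_{33}}+(p_1-p_3)\frac{c_{13}}{c_{33}}.$$ The three functions of two variables are the free initial conditions (one for each of the three equations in (3)) arising when each equation in (3) is solved, as a first order equation, for one of the three unknown functions.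
   Formalization: When κ_2^3 is prescribed and c_33 is unknown, c_33 may be freely prescribed on x_2=0, but uniqueness is stated for data also given on the parts of x_3=0 and x_3=δ where κ_2^3 points into the cube, since values on x_2=0 alone do not determine c_33. *)

(* Defs.v *)
From HB Require Import structures.
From mathcomp Require Import all_boot all_order all_algebra.
From mathcomp Require Import all_classical all_reals all_analysis.
Import Order.TTheory GRing.Theory Num.Theory.
Import numFieldNormedType.Exports.

Set Implicit Arguments.
Unset Strict Implicit.
Unset Printing Implicit Defensive.

Local Open Scope classical_set_scope.
Local Open Scope ring_scope.

Section SmoothFunctions.
Context {R : realType} {n : nat}.
Implicit Types (f g : 'rV[R]_n.+1 -> R) (x : 'rV[R]_n.+1) (l : 'I_n.+1).

Definition cube (delta : R) : set 'rV[R]_n.+1 :=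
  [set x | forall l, 0 <= x ord0 l <= delta].

Definition eq_on_cube (delta : R) f g : Prop :=
  forall x, cube delta x -> f x = g x.

Definition basis_vec l : 'rV[R]_n.+1 := delta_mx ord0 l.

Fixpoint of_class_C (k : nat) f : Prop :=
  if k is k'.+1 then
    [/\ continuous f,
        forall l x, derivable f x (basis_vec l)
      & forall l, of_class_C k' (fun x => 'D_(basis_vec l) f x)]
  else continuous f.

Definition smooth f : Prop := forall k, of_class_C k f.

(* A function on the closed cube is smooth when it is the restriction of a
   smooth function on the whole space.  Functions on the cube are represented
   by total functions whose values off the cube are irrelevant. *)
Definition smooth_on_cube (delta : R) f : Prop :=
  exists2 g, smooth g & eq_on_cube delta f g.

(* The limit is taken inside the cube, so that it is one-sided on the faces
   orthogonal to the l-th axis and depends only on the restriction of f. *)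
Definition partial (delta : R) l f x : R :=
  lim ((fun h : R => h^-1 * (f (x + h *: basis_vec l) - f x))
       @ within [set h | cube delta (x + h *: basis_vec l)] (0 : R)^').

End SmoothFunctions.

Definition i1 : 'I_3 := @Ordinal 3 0 isT.
Definition i2 : 'I_3 := @Ordinal 3 1 isT.
Definition i3 : 'I_3 := @Ordinal 3 2 isT.

Section VacuumData.
Context {R : realType}.
Implicit Types (delta : R) (x : 'rV[R]_3) (f k : 'rV[R]_3 -> R).
Implicit Types (p : 'I_3 -> 'rV[R]_3 -> R) (c : 'I_3 -> 'I_3 -> 'rV[R]_3 -> R).

(* kappa p c i l is the mixed tensor component with lower index i and upper
   index l. *)
Definition kappa p c (i l : 'I_3) x : R :=
  match val i, val l with
  | 0%N, 1%N => (p i1 x - p i2 x) * (c i1 i2 x / c i2 i2 x)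
  | 1%N, 2%N => (p i2 x - p i3 x) * (c i2 i3 x / c i3 i3 x)
  | 0%N, 2%N =>
      (p i2 x - p i1 x) * (c i1 i2 x * c i2 i3 x / (c i2 i2 x * c i3 i3 x))
      + (p i1 x - p i3 x) * (c i1 i3 x / c i3 i3 x)
  | _, _ => if i == l then - p i x else 0
  end.

Definition kasner delta p : Prop :=
  forall x, cube delta x ->
    [/\ p i1 x < p i2 x, p i2 x < p i3 x,
        \sum_(i < 3) p i x = 1 & \sum_(i < 3) p i x ^+ 2 = 1].

Definition diag_prod c x : R := c i1 i1 x * c i2 i2 x * c i3 i3 x.

Definition constraint delta p c (i : 'I_3) x : R :=
  \sum_(l < 3)
    (partial delta i (c l l) x / c l l x * (p l x - p i x)
     + 2 * partial delta l (kappa p c i l) x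
     + (i < l)%N%:R * (partial delta l (diag_prod c) x / diag_prod c x
                       * kappa p c i l x)).

Definition symmetric_on_cube delta c : Prop :=
  forall i j, eq_on_cube delta (c i j) (c j i).

Definition vacuum_data delta p c : Prop :=
  [/\ (forall i, smooth_on_cube delta (p i))
        /\ (forall i j, smooth_on_cube delta (c i j)),
      (forall i x, cube delta x -> 0 < c i i x) /\ symmetric_on_cube delta c,
      kasner delta p
    & forall i x, cube delta x -> constraint delta p c i x = 0].

(* Names for the six functions c_11, c_22, c_33, kappa_1^2, kappa_1^3,
   kappa_2^3. *)
Inductive component := C11 | C22 | C33 | K12 | K13 | K23.

Definition component_val p c (u : component) : 'rV[R]_3 -> R :=
  match u with
  | C11 => c i1 i1
  | C22 => c i2 i2
  | C33 => c i3 i3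
  | K12 => kappa p c i1 i2
  | K13 => kappa p c i1 i3
  | K23 => kappa p c i2 i3
  end.

(* The third, second and first constraints are solved for one member of the
   pairs {C11, C22}, {C33, K23} and {K12, K13} respectively, the other member
   being prescribed. *)
Definition partner (u : component) : component :=
  match u with
  | C11 => C22 | C22 => C11
  | C33 => K23 | K23 => C33
  | K12 => K13 | K13 => K12
  end.

Definition is_diag (u : component) : Prop :=
  match u with C11 | C22 | C33 => True | _ => False end.

Definition positive_if_diag n delta (u : component) (f : 'rV[R]_n.+1 -> R) :=
  is_diag u -> forall y, cube delta y -> 0 < f y.

Definition realizes delta p c (a b g : component)
    (alpha beta gamma eps zeta eta : 'rV[R]_3 -> R) : Prop :=
  [/\ eq_on_cube delta (component_val p c a) alpha,
      eq_on_cube delta (component_val p c b) beta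
    & eq_on_cube delta (component_val p c g) gamma] /\
  [/\ eq_on_cube delta (component_val p c (partner a)) eps,
      eq_on_cube delta (component_val p c (partner b)) zeta
    & eq_on_cube delta (component_val p c (partner g)) eta].

(* The last clause says that the c_ij are determined by the six functions. *)
Definition completes delta p (a b g : component)
    (alpha beta gamma eps zeta eta : 'rV[R]_3 -> R) : Prop :=
  [/\ smooth_on_cube delta eps, smooth_on_cube delta zeta,
      smooth_on_cube delta eta
    & exists c,
      [/\ vacuum_data delta p c,
          realizes delta p c a b g alpha beta gamma eps zeta eta
        & forall c', symmetric_on_cube delta c' ->
            realizes delta p c' a b g alpha beta gamma eps zeta eta ->
            forall i j, eq_on_cube delta (c' i j) (c i j)]].

(* The coordinate l such that the equation solved for u is evolved from the
   face x_l = 0. *)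
Definition evolution_dir (u : component) : 'I_3 :=
  match u with
  | C33 | K12 => i2
  | C11 | C22 | K13 | K23 => i3
  end.

(* The function of two variables f is the value of h on the face x_l = 0. *)
Definition has_initial_value delta (u : component) (h : 'rV[R]_3 -> R)
    (f : 'rV[R]_2 -> R) : Prop :=
  forall x, cube delta x -> x ord0 (evolution_dir u) = 0 ->
    h x = f (col' (evolution_dir u) x).

(* The part of the boundary through which the characteristics of the equation
   solved for u enter the cube.  For u <> C33 the characteristics are parallel
   to a coordinate axis and this is a face.  For u = C33 the second constraint
   is a transport equation for ln c_33 along
   (p_3 - p_2) d/dx_2 + kappa_2^3 d/dx_3, whose characteristics may also enter
   through the faces x_3 = 0 and x_3 = delta, where kappa_2^3 points inwards;
   the values on x_2 = 0 alone do not determine c_33.  k stands for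
   kappa_2^3. *)
Definition inflow_boundary delta k (u : component) : set 'rV[R]_3 :=
  [set x | cube delta x /\
    (x ord0 (evolution_dir u) = 0 \/
     (u = C33 /\ ((x ord0 i3 = 0 /\ 0 < k x) \/
                  (x ord0 i3 = delta /\ k x < 0))))].

Definition same_initial_data delta k (u : component) (f f' : 'rV[R]_3 -> R) :=
  forall x, inflow_boundary delta k u x -> f x = f' x.

End VacuumData.

(* Main.v *)
Require Import Defs.
From HB Require Import structures.
From mathcomp Require Import all_boot all_order all_algebra.
From mathcomp Require Import all_classical all_reals all_analysis.
From mathcomp Require Import ring lra.
Import Order.TTheory GRing.Theory Num.Theory.
Import numFieldNormedType.Exports.

(* The third, second and first constraints, in this order, each involve only
   one new unknown.  For every unknown other than c_33 the equation is a linear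
   ODE along a coordinate axis, solved by an integrating factor.  The second
   constraint for c_33 reads (d/dx_2 + v d/dx_3) c_33 = g c_33 with
   v = kappa_2^3 / (p_3 - p_2), and is solved along the characteristics of v,
   after v has been cut off outside the cube so that its flow is global.  The
   flow is obtained by Picard iteration; its smoothness in the parameters
   follows from Hadamard's lemma and from the fact that, the ODE being scalar,
   the first derivatives of the flow are explicit integrals involving the flow
   itself, so that regularity bootstraps.  Uniqueness is a maximum principle on
   the cube, which needs agreement only where the transport field points
   inwards. *)

Set Implicit Arguments.
Unset Strict Implicit.
Unset Printing Implicit Defensive.

Local Open Scope classical_set_scope.
Local Open Scope ring_scope.

(** * Derivatives and primitives on the line *)

(** Smoothness on the cube means extendability, so all equations are solved on the whole space with
    extended coefficients and are claimed only on the cube. The gaps between the p_i and the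
    diagonal components are extended as positive functions, so that every division stays smooth. For
    c_33 the velocity v depends on x_2, which is also the time of the transport; a flow then needs
    both a time and an elapsed time. It therefore lives on R^4 with coordinates (x_1, t, x_3, s),
    and the solution is read off at s = t. There d/dx_2 + v d/dx_3 becomes d/dt + d/ds + v d/dx_3,
    which commutes with d/ds because v does not depend on s, so the identities propagate from s = 0.
    Extensions off the cube are not unique, and they implicitly supply the values that enter through
    x_3 = 0 and x_3 = delta. Hence existence takes data on x_2 = 0 only, while uniqueness compares
    solutions on the whole inflow boundary. No total derivative is used: Hadamard's lemma, obtained
    by integrating partial derivatives along the edges of a box, yields the chain rule,
    differentiation under the integral sign and the derivatives of the flow. *)

Lemma is_deriveP (R : realType) (V : normedModType R) (f : V -> R) (x v : V) (a : R) :
  is_derive x v f a <->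
  (h^-1 * (f (h *: v + x) - f x)) @[h --> (0:R)^'] --> a.
Proof.
split=> [[fx <-]|H]; first exact: fx.
split; first exact: cvgP H.
exact: cvg_lim H.
Qed.

Section DerivativeRules.
Context {R : realType} {V : normedModType R}.
Implicit Types (f g : V -> R) (x v : V) (a b c : R).

Lemma is_derive_add f g x v a b : is_derive x v f a -> is_derive x v g b ->
  is_derive x v (fun t => f t + g t) (a + b).
Proof. by move=> df dg; exact: (is_deriveD df dg). Qed.

Lemma is_derive_opp f x v a : is_derive x v f a ->
  is_derive x v (fun t => - f t) (- a).
Proof. by move=> df; exact: (is_deriveN df). Qed.

Lemma is_derive_sub f g x v a b : is_derive x v f a -> is_derive x v g b ->
  is_derive x v (fun t => f t - g t) (a - b).
Proof. by move=> df dg; exact: (is_deriveB df dg). Qed.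

Lemma is_derive_const x v c : is_derive x v (fun=> c) 0.
Proof. exact: is_derive_cst. Qed.

Lemma is_derive_mul f g x v a b : is_derive x v f a -> is_derive x v g b ->
  is_derive x v (fun t => f t * g t) (a * g x + f x * b).
Proof.
move=> df dg; have := is_deriveM df dg; rewrite addrC /=.
by rewrite [_ *: a]mulrC.
Qed.

Lemma is_derive_value f x v a b : a = b -> is_derive x v f a -> is_derive x v f b.
Proof. by move=> ->. Qed.

Lemma is_derive_inv f x v a : f x != 0 -> is_derive x v f a ->
  is_derive x v (fun t => (f t)^-1) (- a / f x ^+ 2).
Proof.
move=> f0 [dfx dE]; split; first exact: derivableV.
by rewrite deriveV // dE -[_ *: _]/(_ * _) !mulNr mulrC.
Qed.

(** Restriction to the line through [x] brings a derivative on [V] back to one on the real line,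
    where the one-variable chain rule and continuity of differentiable functions apply. *)
Lemma is_derive_along f x v a :
  is_derive x v f a <-> is_derive (0 : R) 1 (fun h => f (h *: v + x)) a.
Proof.
rewrite !is_deriveP scale0r add0r.
suff -> : (fun h : R => h^-1 * (f (h *: v + x) - f x)) =
  (fun h : R => h^-1 * (f ((h *: (1 : R^o) + 0 : R) *: v + x) - f x)) by [].
by apply/funext => h; rewrite addr0 [h *: 1]mulr1.
Qed.

Lemma is_derive_comp1 (F : R -> R) f x v a b :
  is_derive (f x) 1 F b -> is_derive x v f a ->
  is_derive x v (fun t => F (f t)) (b * a).
Proof.
move=> dF; rewrite !is_derive_along => df.
have dF' : is_derive (f (0 *: v + x)) 1 F b by rewrite scale0r add0r.
exact: is_derive1_comp dF' df.
Qed.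

Lemma is_derive_exp f x v a : is_derive x v f a ->
  is_derive x v (fun t => expR (f t)) (expR (f x) * a).
Proof. by move=> df; apply: is_derive_comp1 df; exact: is_derive_expR. Qed.

End DerivativeRules.

Section DerivativeLine.
Context {R : realType}.

Lemma is_derive_ident (r : R) : is_derive r 1 (fun t => t) 1.
Proof. exact: is_derive_id. Qed.

Lemma is_derive_affine (a c r : R) : is_derive r 1 (fun t => a + t * c) c.
Proof.
apply: is_derive_value (is_derive_add (is_derive_const r 1 a)
  (is_derive_mul (is_derive_ident r) (is_derive_const r 1 c))).
by rewrite mulr0 mul1r add0r addr0.
Qed.
End DerivativeLine.

Section OneVariable.
Context {R : realType}.
Implicit Types (f g : R -> R) (a b r s : R).

(** The endpoints are unordered, so that estimates on primitives from 0 to [s] need no case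
    distinction on the sign of [s]. *)
Definition between a b r := Num.min a b <= r <= Num.max a b.

Lemma betweenC a b r : between a b r = between b a r.
Proof. by rewrite /between minC maxC. Qed.

Lemma is_derive_continuous f r d : is_derive r 1 f d -> {for r, continuous f}.
Proof.
by move=> [fr _]; apply/differentiable_continuous/derivable1_diffP.
Qed.

Lemma mean_value f (df : R -> R) a b :
  (forall r, between a b r -> is_derive r 1 f (df r)) ->
  exists2 c, between a b c & f b - f a = df c * (b - a).
Proof.
wlog ab : a b / a <= b => [H|].
  case: (leP a b) => [/H|/ltW /H] // {}H dfab.
  have [r|c cba E] := H; first by rewrite betweenC; exact: dfab.
  by exists c; rewrite 1?betweenC // -opprB E -mulrN opprB.
rewrite /between min_l // max_r // => dfab.
have [r|r|c] := @MVT_segment _ f df a b ab.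
- by move=> rab; apply: dfab; rewrite !(itvP rab).
- apply: continuous_in_subspaceT => {}r /set_mem /= rab.
  by apply: is_derive_continuous (dfab r _); rewrite !(itvP rab).
- by move=> cab E; exists c; rewrite ?(itvP cab).
Qed.

Lemma mean_value_bound f (df : R -> R) M a b :
  (forall r, between a b r -> is_derive r 1 f (df r)) ->
  (forall r, between a b r -> `|df r| <= M) ->
  `|f b - f a| <= M * `|b - a|.
Proof.
by move=> /mean_value[c cab ->] /(_ _ cab) H; rewrite normrM ler_wpM2r.
Qed.

Lemma is_derive_eq_between f g (d : R -> R) a b :
  (forall r, between a b r -> is_derive r 1 f (d r)) ->
  (forall r, between a b r -> is_derive r 1 g (d r)) ->
  f a = g a -> f b = g b.
Proof.
move=> df dg E.
have H r : between a b r -> is_derive r 1 (f - g) (d r - d r).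
  by move=> rab; have := df r rab; have := dg r rab => ? ?; apply: is_deriveB.
have [c _] := mean_value H.
by rewrite /= !fctE E !subrr mul0r subr0 => /subr0_eq.
Qed.

Let mu := @lebesgue_measure R.

(** This is the oriented integral from 0 to [s]. The base point lies strictly below both 0 and [s],
    so the two integrals run over genuine intervals also when [s] is negative. *)
Definition prim f s : R :=
  let a := - (`|s| + 1) in
  \int[mu]_(t in `[a, s]) f t - \int[mu]_(t in `[a, 0]) f t.

Lemma is_derive_Rintegral f a s : continuous f -> a < s ->
  is_derive s 1 (fun s => \int[mu]_(t in `[a, s]) f t)%R (f s).
Proof.
move=> cf as_.
have [||||] := @continuous_FTC1_closed _ f a s (s + 1).
- by rewrite ltrDl.
- apply: continuous_compact_integrable; first exact: segment_compact.
  by apply: continuous_subspaceT.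
- by [].
- exact: cf.
- move=> D E; split; first exact: D.
  by rewrite -derive1E; exact: E.
Qed.

(** The base point in [prim] moves with [s], which prevents direct differentiation. Two choices of
    base point give functions with the same derivative and the same value at 0, so the base point
    can be frozen. *)
Lemma prim_shift f a s : continuous f -> a < s -> a < 0 ->
  prim f s = (\int[mu]_(t in `[a, s]) f t - \int[mu]_(t in `[a, 0]) f t)%R.
Proof.
move=> cf as_ a0; rewrite /prim; set b := - _.
have bs : b < s by rewrite /b; have := ler_norm (- s); rewrite normrN; lra.
have b0 : b < 0 by rewrite /b; have := normr_ge0 s; lra.
pose F c x := (\int[mu]_(t in `[c, x]) f t - \int[mu]_(t in `[c, 0]) f t)%R.
have dF c : c < s -> c < 0 ->
    forall r, between 0 s r -> is_derive r 1 (F c) (f r).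
  move=> cs c0 r rs; have cr : c < r.
    by move: rs; rewrite /between; case: (leP 0 s) => ?; lra.
  have ? := is_derive_Rintegral cf cr.
  by rewrite -[f r]subr0; apply: is_deriveB.
apply: (@is_derive_eq_between (F b) (F a) f 0 s); [exact: dF..|].
by rewrite /F !subrr.
Qed.

Lemma is_derive_prim f s : continuous f -> is_derive s 1 (prim f) (f s).
Proof.
move=> cf; pose a := - (`|s| + 1).
have as_ : a < s by rewrite /a; have := ler_norm (- s); rewrite normrN; lra.
have a0 : a < 0 by rewrite /a; have := normr_ge0 s; lra.
pose F x := (\int[mu]_(t in `[a, x]) f t - \int[mu]_(t in `[a, 0]) f t)%R.
apply: (@near_eq_is_derive _ _ _ F).
  have : \forall x \near s, a < x by exact: lt_nbhsr.
  by apply: filterS => x ax; rewrite (prim_shift cf ax a0).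
have ? := is_derive_Rintegral cf as_.
by rewrite -[f s]subr0; apply: is_deriveB.
Qed.

Lemma prim0 f : prim f 0 = 0.
Proof. by rewrite /prim subrr. Qed.

Lemma prim_unique f (F : R -> R) s :
  continuous f -> F 0 = 0 -> (forall r, is_derive r 1 F (f r)) -> F s = prim f s.
Proof.
move=> cf F0 dF.
have H0 : F 0 = prim f 0 by rewrite F0 prim0.
have dP r : between 0 s r -> is_derive r 1 (prim f) (f r).
  by move=> _; exact: is_derive_prim.
by have := is_derive_eq_between (fun r _ => dF r) dP H0.
Qed.

Lemma prim_dist f g e s : continuous f -> continuous g ->
  (forall r, between 0 s r -> `|f r - g r| <= e) ->
  `|prim f s - prim g s| <= e * `|s|.
Proof.
move=> cf cg H.
have dP r : between 0 s r -> is_derive r 1 (prim f - prim g) (f r - g r).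
  move=> _; have ? := is_derive_prim r cf; have ? := is_derive_prim r cg.
  exact: is_deriveB.
by have := mean_value_bound dP H; rewrite !fctE !prim0 !subr0.
Qed.

Lemma prim_bound f e s : continuous f ->
  (forall r, between 0 s r -> `|f r| <= e) -> `|prim f s| <= e * `|s|.
Proof.
move=> cf H.
have dP r : between 0 s r -> is_derive r 1 (prim f) (f r).
  by move=> _; exact: is_derive_prim.
by have := mean_value_bound dP H; rewrite prim0 !subr0.
Qed.

End OneVariable.

Lemma continuousP_comp (S T U : topologicalType) (f : S -> T) (g : T -> U) :
  continuous f -> continuous g -> continuous (fun x => g (f x)).
Proof. by move=> cf cg x; apply: continuous_comp; [exact: cf|exact: cg]. Qed.

Lemma continuousP_pair (S T U : topologicalType) (f : S -> T) (g : S -> U) :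
  continuous f -> continuous g -> continuous (fun x => (f x, g x)).
Proof. by move=> cf cg x; apply: cvg_pair; [exact: cf|exact: cg]. Qed.

Section ContinuityInParameters.
Context {R : realType} {T : topologicalType}.
Implicit Types (f : T -> R -> R) (t : T) (r s : R).

Lemma continuous_pairl f t : continuous (fun u => f u.1 u.2) -> continuous (f t).
Proof.
move=> cf; apply: (@continuousP_comp R (T * R)%type R (fun r => (t, r))) cf.
by apply: continuousP_pair; [exact: cst_continuous|move=> r; exact: cvg_id].
Qed.

(** A tube lemma: joint continuity gives neighbourhoods of each point (t0, r0), and compactness of
    the segment selects one neighbourhood of [t0] that serves all [r]. *)
Lemma near_uniform f t0 (M e : R) : continuous (fun u => f u.1 u.2) -> 0 < e ->
  \forall t \near t0, forall r, `|r| <= M -> `|f t r - f t0 r| <= e.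
Proof.
move=> cf e0; have e20 : 0 < e / 2 by lra.
have K := @segment_compact R (- M) M.
have cov r0 : `[- M, M]%classic r0 ->
    \forall r \near r0 & t \near t0, `|f t r - f t0 r| <= e.
  move=> _; have /cvgrPdist_le /(_ _ e20) := cf (t0, r0).
  case=> -[A B] /= [A0 B0] AB; exists (B, A) => // -[r t] [/= Br At].
  have := AB (t, r) (conj At Br).
  have := AB (t0, r) (conj (nbhs_singleton A0) Br).
  rewrite /= => H1 H2.
  have -> : f t r - f t0 r = (f t0 r0 - f t0 r) - (f t0 r0 - f t r) by ring.
  by rewrite (le_trans (ler_normB _ _)) //; lra.
have := (compact_near_coveringP `[- M, M]%classic).1 K T (nbhs t0)
  (fun t r => `|f t r - f t0 r| <= e) (nbhs_filter t0) cov.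
by apply: filterS => t H r rM; apply: H; rewrite /= in_itv /= -ler_norml.
Qed.

(** The error is split in two: moving the endpoint with the parameter fixed, where [prim] is
    differentiable, and moving the parameter with the endpoint fixed, where the integrands are
    uniformly close on [-M, M]. *)
Lemma continuous_prim f : continuous (fun u => f u.1 u.2) ->
  continuous (fun u : T * R => prim (f u.1) u.2).
Proof.
move=> cf [t0 s0]; apply/cvgrPdist_le => /= e e0.
pose M := `|s0| + 1; have M0 : 0 < M by rewrite /M; have := normr_ge0 s0; lra.
have cP := is_derive_continuous (is_derive_prim s0 (@continuous_pairl f t0 cf)).
have /cvgrPdist_le /(_ (e / 2)) [|B B0 HB] := cP; first lra.
have eM : 0 < e / 2 / M by rewrite !divr_gt0.
have H := near_uniform t0 M cf eM.
have nM : \forall s \near s0, `|s| <= M.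
  exists 1 => //= s; rewrite /= /M => s1.
  by have := ler_normB s0 (s0 - s); rewrite opprB addrCA subrr addr0; lra.
have H' : \forall u \near (t0, s0), (fun u : T * R =>
    forall r, `|r| <= M -> `|f u.1 r - f t0 r| <= e / 2 / M) u.
  by exists ([set t | forall r, `|r| <= M -> `|f t r - f t0 r| <= e / 2 / M], setT);
    [split=> //; exact: filterT|move=> -[t s] []].
have B' : \forall u \near (t0, s0), (fun u : T * R => `|u.2| <= M /\
    `|prim (f t0) s0 - prim (f t0) u.2| <= e / 2) u.
  exists (setT, [set s | `|s| <= M /\ `|prim (f t0) s0 - prim (f t0) s| <= e / 2]).
    split; first exact: filterT.
    by apply: filterI => //; exists B.
  by move=> -[t s] [].
apply: filterS2 H' B' => -[t s] /= h [sM h'].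
have -> : prim (f t0) s0 - prim (f t) s =
  (prim (f t0) s0 - prim (f t0) s) - (prim (f t) s - prim (f t0) s) by ring.
apply: le_trans (ler_normB _ _) _.
have : `|prim (f t) s - prim (f t0) s| <= e / 2 / M * `|s|.
  apply: prim_dist; [exact: continuous_pairl..|].
  move=> r rs; apply: h; apply: le_trans sM.
  by move: rs; rewrite /between; case: (leP 0 s) => s0' /andP[] *;
    rewrite ler_norml; [rewrite ger0_norm|rewrite ltr0_norm]; lra.
have : e / 2 / M * `|s| <= e / 2 / M * M by rewrite ler_wpM2l // ltW.
by rewrite divfK ?gt_eqF //; lra.
Qed.

End ContinuityInParameters.

(** * Functions of several variables *)

Section Coordinates.
Context {R : realType} {n : nat}.
Implicit Types (f g : 'rV[R]_n.+1 -> R) (x y : 'rV[R]_n.+1) (l j : 'I_n.+1).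

Definition upd l x (r : R) := x + (r - x ord0 l) *: basis_vec l.

Lemma updE l x r j : upd l x r ord0 j = if j == l then r else x ord0 j.
Proof.
rewrite /upd /basis_vec !mxE eqxx /=.
by case: eqP => [->|_]; rewrite ?mulr1 ?mulr0 ?addr0 // addrC subrK.
Qed.

Lemma upd_same l x : upd l x (x ord0 l) = x.
Proof. by rewrite /upd subrr scale0r addr0. Qed.

Lemma upd_upd l x r s : upd l (upd l x r) s = upd l x s.
Proof. by apply/rowP => j; rewrite !updE; case: eqP. Qed.

Lemma upd_line l x h : h *: basis_vec l + x = upd l x (h + x ord0 l).
Proof. by rewrite /upd addrK addrC. Qed.

Lemma is_derive_upd f x l d :
  is_derive x (basis_vec l) f d <->
  is_derive (x ord0 l) 1 (fun r => f (upd l x r)) d.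
Proof.
rewrite !is_deriveP upd_same.
suff -> : (fun h : R => h^-1 * (f (h *: basis_vec l + x) - f x)) =
  (fun h : R => h^-1 * (f (upd l x (h *: 1 + x ord0 l)) - f x)) by [].
by apply/funext => h; rewrite upd_line [h *: 1]mulr1.
Qed.

Lemma is_derive_line f x l r d :
  is_derive (upd l x r) (basis_vec l) f d <->
  is_derive r 1 (fun r => f (upd l x r)) d.
Proof.
rewrite is_derive_upd updE eqxx.
by under eq_fun do rewrite upd_upd.
Qed.

End Coordinates.

Section RowContinuity.
Context {R : realType} {T : topologicalType}.

Lemma cvg_row (F : set_system T) {FF : Filter F} m (phi : 'I_m -> T -> R)
    (a : 'I_m -> R) :
  (forall j, phi j @ F --> a j) ->
  (fun t => \row_j phi j t : 'rV[R]_m) @ F --> \row_j a j.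
Proof.
move=> cphi; apply/cvgrPdist_le => /= e e0; near=> x.
rewrite /Num.Def.normr/= mx_normrE (bigmax_le _ (ltW e0))//= => i _.
rewrite !mxE/=; move: i; near: x; apply: filter_forall => /= i.
by have /cvgrPdist_le := cphi i.2; apply.
Unshelve. all: by end_near. Qed.

Lemma continuous_row m (phi : 'I_m -> T -> R) :
  (forall j, continuous (phi j)) -> continuous (fun t => \row_j phi j t : 'rV[R]_m).
Proof. by move=> cphi t; apply: cvg_row => j; exact: cphi. Qed.

Lemma continuous_coord m (phi : T -> 'rV[R]_m) j :
  continuous phi -> continuous (fun t => phi t ord0 j).
Proof.
by move=> c; apply: (continuousP_comp c (@coord_continuous R 1 m ord0 j)).
Qed.

Lemma continuous_upd m l (phi : T -> 'rV[R]_m.+1) (r : T -> R) :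
  continuous phi -> continuous r -> continuous (fun t => upd l (phi t) (r t)).
Proof.
move=> cphi cr.
have -> : (fun t => upd l (phi t) (r t)) =
    (fun t => \row_j if j == l then r t else phi t ord0 j).
  by apply/funext => t; apply/rowP => j; rewrite updE mxE.
by apply: continuous_row => j; case: eqP => // _; exact: continuous_coord.
Qed.

End RowContinuity.

Section Arithmetic.
Context {R : realType} {T : topologicalType}.
Implicit Types f g : T -> R.

Lemma continuousP_add f g :
  continuous f -> continuous g -> continuous (fun t => f t + g t).
Proof. by move=> cf cg t; apply: cvgD; [exact: cf|exact: cg]. Qed.

Lemma continuousP_opp f : continuous f -> continuous (fun t => - f t).
Proof. by move=> cf t; apply: cvgN; exact: cf. Qed.

Lemma continuousP_sub f g :
  continuous f -> continuous g -> continuous (fun t => f t - g t).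
Proof. by move=> cf cg t; apply: cvgB; [exact: cf|exact: cg]. Qed.

Lemma continuousP_mul f g :
  continuous f -> continuous g -> continuous (fun t => f t * g t).
Proof. by move=> cf cg t; apply: cvgM; [exact: cf|exact: cg]. Qed.

Lemma continuousP_inv f :
  continuous f -> (forall t, f t != 0) -> continuous (fun t => (f t)^-1).
Proof. by move=> cf f0 t; apply: cvgV => //; exact: cf. Qed.

End Arithmetic.

(** * Hadamard's lemma, the chain rule and differentiation under the integral sign *)

Section Hadamard.
Context {R : realType} {n : nat}.
Variables (f : 'rV[R]_n.+1 -> R) (df : 'I_n.+1 -> 'rV[R]_n.+1 -> R).
Hypothesis fdf : forall l x, is_derive x (basis_vec l) f (df l x).
Hypothesis cdf : forall l, continuous (df l).

(** Vertices of a path from [x] to [y] that changes one coordinate at a time. Each edge is parallel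
    to an axis, so only one partial derivative enters on it and no chain rule is presupposed. *)
Let mix k (x y : 'rV[R]_n.+1) : 'rV[R]_n.+1 :=
  \row_i if (i < k)%N then y ord0 i else x ord0 i.

Let A (l : 'I_n.+1) (x y : 'rV[R]_n.+1) : R :=
  prim (fun th => df l (upd l (mix l x y) (x ord0 l + th * (y ord0 l - x ord0 l)))) 1.

(** The integrand of [A] with both end points packed into one parameter, the form in which
    [continuous_prim] applies. *)
Let seg (l : 'I_n.+1) (u : 'rV[R]_n.+1 * 'rV[R]_n.+1) (th : R) : R :=
  df l (upd l (mix l u.1 u.2) (u.1 ord0 l + th * (u.2 ord0 l - u.1 ord0 l))).

Let continuous_seg l : continuous (fun u => seg l u.1 u.2).
Proof.
apply: (@continuousP_comp _ _ _ (fun u : ('rV[R]_n.+1 * 'rV[R]_n.+1) * R =>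
  upd l (mix l u.1.1 u.1.2)
    (u.1.1 ord0 l + u.2 * (u.1.2 ord0 l - u.1.1 ord0 l))) _ _ (cdf (l := l))).
have c1 : continuous (fun u : ('rV[R]_n.+1 * 'rV[R]_n.+1) * R => u.1.1).
  by move=> u; apply: cvg_comp; exact: cvg_fst.
have c2 : continuous (fun u : ('rV[R]_n.+1 * 'rV[R]_n.+1) * R => u.1.2).
  by move=> u; apply: cvg_comp; [exact: cvg_fst|exact: cvg_snd].
have c3 : continuous (fun u : ('rV[R]_n.+1 * 'rV[R]_n.+1) * R => u.2).
  by move=> u; exact: cvg_snd.
have d1 j := @continuous_coord _ _ n.+1 _ j c1.
have d2 j := @continuous_coord _ _ n.+1 _ j c2.
apply: continuous_upd.
  by apply: continuous_row => j; case: (j < l)%N; [exact: d2|exact: d1].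
apply: continuousP_add (d1 l) _.
exact: continuousP_mul c3 (continuousP_sub (d2 l) (d1 l)).
Qed.

(** The increment of [f] telescopes over the edges of the path, and on each edge it is the integral
    of one partial derivative times the change of that coordinate. The coefficients are continuous
    up to the diagonal, so difference quotients become continuous functions of the increment. *)
Lemma hadamard : exists A : 'I_n.+1 -> 'rV[R]_n.+1 -> 'rV[R]_n.+1 -> R,
  [/\ forall l, continuous (fun u => A l u.1 u.2),
      forall x y, f y - f x = \sum_l A l x y * (y ord0 l - x ord0 l)
    & forall l x, A l x x = df l x].
Proof.
exists A; split.
- move=> l.
  have H := continuous_prim (@continuous_seg l).
  have c1 : continuous (fun u : 'rV[R]_n.+1 * 'rV[R]_n.+1 => (u, 1 : R)).
    by apply: continuousP_pair; [move=> u; exact: cvg_id|exact: cst_continuous].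
  exact: (continuousP_comp c1 H).
- move=> x y.
  pose z k := mix k x y.
  have -> : f y - f x = f (z n.+1) - f (z 0%N).
    by congr (f _ - f _); apply/rowP => i; rewrite mxE ?ltn_ord.
  rewrite -(telescope_sumr (fun k => f (z k))) // big_mkord.
  apply: eq_bigr => l _.
  pose c := y ord0 l - x ord0 l.
  pose F th := f (upd l (z l) (x ord0 l + th * c)).
  (* The vertices [z l] and [z l.+1] differ in coordinate [l] only; they are the ends th = 0 and th
     = 1 of the edge. *)
  have -> : z l.+1 = upd l (z l) (x ord0 l + 1 * c).
    apply/rowP => i; rewrite updE !mxE /c mul1r addrC subrK ltnS leq_eqVlt.
    by case: (eqVneq i l) => [->|ne]; rewrite ?eqxx //= (negbTE (_ : i != l :> nat)).
  have -> : z l = upd l (z l) (x ord0 l + 0 * c).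
    apply/rowP => i; rewrite updE !mxE mul0r addr0.
    by case: (eqVneq i l) => [->|//]; rewrite ltnn.
  rewrite upd_upd -/c.
  pose g th := seg l (x, y) th.
  have cg : continuous g := @continuous_pairl _ _ _ (x, y) (@continuous_seg l).
  have dF (r : R) : is_derive r 1 F (g r * c).
    have -> : F = (fun r => f (upd l (z l) r)) \o (fun th => x ord0 l + th * c) by [].
    apply: is_derive1_comp; first by apply/is_derive_line; exact: fdf.
    exact: is_derive_affine.
  have dG (r : R) : is_derive r 1 (fun th => prim g th * c + F 0) (g r * c).
    apply: is_derive_value (is_derive_add (is_derive_mul (is_derive_prim r cg)
      (is_derive_const r 1 c)) (is_derive_const r 1 (F 0))).
    by rewrite mulr0 !addr0.
  have E := @is_derive_eq_between _ F (fun th => prim g th * c + F 0) (fun r => g r * c) 0 1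
     (fun r _ => dF r) (fun r _ => dG r).
  change (F 1 - F 0 = prim g 1 * c).
  by rewrite E ?prim0 ?mul0r ?add0r // addrK.
- move=> l x.
  (* On the diagonal every edge degenerates to the point [x], so the integrand is constant on the
     unit interval. *)
  have -> : A l x x = prim (fun=> df l x) 1.
    congr (prim _ _); apply/funext => th.
    congr (df l _); rewrite subrr mulr0 addr0.
    by apply/rowP => i; rewrite updE mxE; case: eqP => [->//|_]; case: ifP.
  rewrite -[RHS]mul1r; apply/esym.
  apply: (@prim_unique _ _ (fun r => r * df l x)).
  - exact: cst_continuous.
  - by rewrite mul0r.
  - move=> r; apply: is_derive_value (is_derive_mul (is_derive_ident r)
      (is_derive_const r 1 (df l x))).
    by rewrite mul1r mulr0 addr0.
Qed.
End Hadamard.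

Section ChainRule.
Context {R : realType} {n : nat} {V : normedModType R}.
Variables (f : 'rV[R]_n.+1 -> R) (df : 'I_n.+1 -> 'rV[R]_n.+1 -> R).
Hypothesis fdf : forall l x, is_derive x (basis_vec l) f (df l x).
Hypothesis cdf : forall l, continuous (df l).

(** Hadamard's lemma writes the difference quotient as a sum of continuous coefficients times the
    difference quotients of the [phi j]; the limit is then taken term by term. *)
Lemma is_derive_comp (phi : 'I_n.+1 -> V -> R) (x v : V) (d : 'I_n.+1 -> R) :
  (forall j, is_derive x v (phi j) (d j)) ->
  is_derive x v (fun t => f (\row_j phi j t))
    (\sum_j df j (\row_j phi j x) * d j).
Proof.
move=> dphi; have [A [cA EA A1]] := hadamard fdf cdf.
pose P t : 'rV[R]_n.+1 := \row_j phi j t.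
apply/is_deriveP.
have -> : (fun h : R => h^-1 * (f (P (h *: v + x)) - f (P x))) =
  (fun h : R => \sum_j A j (P x) (P (h *: v + x)) *
     (h^-1 * (phi j (h *: v + x) - phi j x))).
  apply/funext => h; rewrite EA mulr_sumr; apply: eq_bigr => j _.
  by rewrite !mxE; ring.
apply: cvg_big => [|j _]; first exact: add_continuous.
apply: cvgM; last by apply/is_deriveP; exact: dphi.
rewrite -A1; have cPx : P (h *: v + x) @[h --> (0 : R)^'] --> P x.
  apply: cvg_row => i; apply: cvg_within_filter.
  have /is_derive_continuous c := (is_derive_along _ _ _ _).1 (dphi i).
  have E : phi i x = (fun h : R => phi i (h *: v + x)) 0 by rewrite scale0r add0r.
  by rewrite E; exact: c.
have cPP : (P x, P (h *: v + x)) @[h --> (0 : R)^'] --> (P x, P x).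
  exact: (cvg_pair (cvg_cst (P x)) cPx).
exact: (@cvg_comp _ _ _ (fun h : R => (P x, P (h *: v + x)))
  (fun u => A j u.1 u.2) _ _ _ cPP (cA j (P x, P x))).
Qed.

End ChainRule.

Section PrimCoordinate.
Context {R : realType} {n : nat}.
Implicit Types (f g : 'rV[R]_n.+1 -> R) (x : 'rV[R]_n.+1) (l j : 'I_n.+1).

Definition primc l f x : R := prim (fun r => f (upd l x r)) (x ord0 l).

Lemma continuous_line l f x : continuous f -> continuous (fun r => f (upd l x r)).
Proof.
move=> cf; apply: (@continuousP_comp _ _ _ (fun r => upd l x r) f _ cf).
by apply: continuous_upd; [exact: cst_continuous|move=> r; exact: cvg_id].
Qed.

Lemma continuous_upd_pair l (f : 'rV[R]_n.+1 -> R) : continuous f ->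
  continuous (fun u : 'rV[R]_n.+1 * R => f (upd l u.1 u.2)).
Proof.
move=> cf; apply: (@continuousP_comp _ _ _ (fun u : 'rV[R]_n.+1 * R => upd l u.1 u.2) f _ cf).
by apply: continuous_upd => u; [exact: cvg_fst|exact: cvg_snd].
Qed.

Lemma continuous_primc l f : continuous f -> continuous (primc l f).
Proof.
move=> cf; have H := @continuous_prim _ _ (fun x r => f (upd l x r))
  (@continuous_upd_pair l f cf).
apply: (@continuousP_comp _ _ _ (fun x => (x, x ord0 l))
  (fun u => prim (fun r => f (upd l u.1 r)) u.2) _ H).
by apply: continuousP_pair; [move=> x; exact: cvg_id|exact: coord_continuous].
Qed.

Lemma primc_upd l f x r : primc l f (upd l x r) = prim (fun r => f (upd l x r)) r.
Proof. by rewrite /primc updE eqxx; under eq_fun do rewrite upd_upd. Qed.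

Lemma primc0 l f x : x ord0 l = 0 -> primc l f x = 0.
Proof. by rewrite /primc => ->; exact: prim0. Qed.

Lemma is_derive_primc l f x : continuous f ->
  is_derive x (basis_vec l) (primc l f) (f x).
Proof.
move=> cf; apply/is_derive_upd; under eq_fun do rewrite primc_upd.
by rewrite -[in f x](upd_same l x); apply: is_derive_prim; exact: continuous_line.
Qed.

Lemma is_derive_basis_coord l j x :
  is_derive x (basis_vec l) (fun y => y ord0 j) (l == j)%:R.
Proof.
apply/is_derive_upd; under eq_fun do rewrite updE eq_sym.
by case: eqP => _; [exact: is_derive_ident|exact: is_derive_const].
Qed.

Lemma upd_shift l j x r h : j != l ->
  upd l (h *: basis_vec j + x) r = h *: basis_vec j + upd l x r.
Proof.
move=> jl; have lj : l != j by rewrite eq_sym.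
rewrite !upd_line; apply/rowP => i; rewrite !updE.
by case: (eqVneq i l) => [->|_]; rewrite ?(negbTE lj) ?(negbTE jl).
Qed.

(** Differentiation under the integral sign. Hadamard's lemma turns the quotient in direction [j]
    into the primitive of [q h], jointly continuous in [h] and the integration variable, so the
    limit is a value of a continuous function rather than an exchange of limits. *)
Lemma is_derive_primc_other l j f (df : 'I_n.+1 -> 'rV[R]_n.+1 -> R) x :
  (forall l x, is_derive x (basis_vec l) f (df l x)) ->
  (forall l, continuous (df l)) -> continuous f -> j != l ->
  is_derive x (basis_vec j) (primc l f) (primc l (df j) x).
Proof.
move=> fdf cdf cf jl; have [A [cA EA A1]] := hadamard fdf cdf.
pose e : 'rV[R]_n.+1 := basis_vec j.
pose q (h r : R) := A j (upd l x r) (upd j (upd l x r) (h + (upd l x r) ord0 j)).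
have cq : continuous (fun u => q u.1 u.2).
  have c1 : continuous (fun u : R * R => u.1) by move=> u; exact: cvg_fst.
  have c2 : continuous (fun u : R * R => u.2) by move=> u; exact: cvg_snd.
  have cx : continuous (fun u : R * R => upd l x u.2).
    by apply: continuous_upd; [exact: cst_continuous|exact: c2].
  have cy := @continuous_upd _ _ _ j _ _ cx
    (continuousP_add c1 (@continuous_coord _ _ _ _ j cx)).
  exact: (@continuousP_comp _ _ _ (fun u : R * R =>
    (upd l x u.2, upd j (upd l x u.2) (u.1 + (upd l x u.2) ord0 j)))
    (fun u => A j u.1 u.2) (continuousP_pair cx cy) (cA j)).
apply/is_deriveP.
have H : prim (q h) (x ord0 l) @[h --> (0 : R)] --> prim (q 0) (x ord0 l).
  have c1 : continuous (fun h : R => (h, x ord0 l)).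
    by apply: continuousP_pair; [move=> h; exact: cvg_id|exact: cst_continuous].
  exact: (@continuousP_comp _ _ _ (fun h : R => (h, x ord0 l))
    (fun u => prim (q u.1) u.2) c1 (continuous_prim cq)).
have -> : primc l (df j) x = prim (q 0) (x ord0 l).
  congr (prim _ _); apply/funext => r.
  by rewrite /q add0r upd_same A1.
have H' : prim (q h) (x ord0 l) @[h --> (0 : R)^'] --> prim (q 0) (x ord0 l).
  by apply: cvg_within_filter; exact: H.
apply: cvg_trans H'.
apply: near_eq_cvg; near=> h.
have h0 : h != 0 by near: h; exact: nbhs_dnbhs_neq.
apply: (mulfI h0); rewrite mulrA divff // mul1r /primc.
have -> : (h *: basis_vec j + x) ord0 l = x ord0 l.
  by rewrite upd_line updE eq_sym (negbTE jl).
have cl y := @continuous_line l f y cf.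
have cqh : continuous (q h) := @continuous_pairl _ _ q h cq.
(* As functions of the upper limit both sides vanish at 0 and have derivative [h * q h r]: the two
   points differ in coordinate [j] only, so the Hadamard sum has a single nonzero term. *)
apply: (@is_derive_eq_between _ (fun s => h * prim (q h) s)
  (fun s => prim (fun r => f (upd l (h *: basis_vec j + x) r)) s -
            prim (fun r => f (upd l x r)) s) (fun r => h * q h r) 0) => [r _|r _|].
- apply: is_derive_value (is_derive_mul (is_derive_const r 1 h) (is_derive_prim r cqh)).
  by rewrite mul0r add0r.
- apply: is_derive_value (is_derive_sub (is_derive_prim r (cl (h *: basis_vec j + x)))
    (is_derive_prim r (cl x))).
  rewrite upd_shift // upd_line EA (bigD1 j) //= big1 ?addr0.
    by rewrite (updE j) eqxx addrK mulrC.
  by move=> i ij; rewrite (updE j) (negbTE ij) subrr mulr0.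
- by rewrite !prim0 mulr0 subrr.
Unshelve. all: by end_near. Qed.

End PrimCoordinate.

Definition pd {R : realType} {n : nat} (l : 'I_n.+1) (f : 'rV[R]_n.+1 -> R) x : R :=
  'D_(basis_vec l) f x.

Lemma pdE {R : realType} {n : nat} (f : 'rV[R]_n.+1 -> R) l x d :
  is_derive x (basis_vec l) f d -> pd l f x = d.
Proof. by case. Qed.

(** * Closure properties of functions of class C^k *)

Section ClassC.
Context {R : realType} {n : nat}.
Implicit Types (f g : 'rV[R]_n.+1 -> R) (x : 'rV[R]_n.+1) (l j : 'I_n.+1).

Lemma classC_continuous k f : of_class_C k f -> continuous f.
Proof. by case: k => [|k] // -[]. Qed.

Lemma classC_is_derive k f l x : of_class_C k.+1 f ->
  is_derive x (basis_vec l) f (pd l f x).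
Proof. by case=> _ df _; split=> //; exact: df. Qed.

Lemma classC_pd k f l : of_class_C k.+1 f -> of_class_C k (pd l f).
Proof. by move=> [_ _ Cf]; exact: Cf. Qed.

Lemma classC_intro k f (df : 'I_n.+1 -> 'rV[R]_n.+1 -> R) :
  (forall l x, is_derive x (basis_vec l) f (df l x)) ->
  continuous f -> (forall l, of_class_C k (df l)) -> of_class_C k.+1 f.
Proof.
move=> fdf cf cdf; split.
- exact: cf.
- by move=> l x; case: (fdf l x).
- move=> l; rewrite (_ : (fun x => _) = df l) //.
  by apply/funext => x; exact: pdE.
Qed.

Lemma classC_pred k f : of_class_C k.+1 f -> of_class_C k f.
Proof.
elim: k f => [|k IH] f; first exact: classC_continuous.
by move=> [cf df Cf]; split=> // l; apply: IH; exact: Cf.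
Qed.

Lemma classC_cst k (c : R) : of_class_C k (fun _ : 'rV[R]_n.+1 => c).
Proof.
elim: k c => [|k IH] c; first exact: cst_continuous.
apply: (@classC_intro _ _ (fun _ _ => 0)) => [|l].
- exact: cst_continuous.
- exact: IH.
Qed.

Lemma classC_coord k j : of_class_C k (fun x : 'rV[R]_n.+1 => x ord0 j).
Proof.
case: k => [|k]; first exact: coord_continuous.
apply: (@classC_intro _ _ (fun l _ => (l == j)%:R)) => [l x||l].
- exact: is_derive_basis_coord.
- exact: coord_continuous.
- exact: classC_cst.
Qed.

Lemma classC_add k f g : of_class_C k f -> of_class_C k g ->
  of_class_C k (fun x => f x + g x).
Proof.
elim: k f g => [|k IH] f g Cf Cg; first exact: continuousP_add.
apply: (@classC_intro _ _ (fun l x => pd l f x + pd l g x)) => [l x||l].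
- by apply: is_derive_add; apply: classC_is_derive; eassumption.
- by apply: continuousP_add; apply: classC_continuous; eassumption.
- by apply: IH; exact: classC_pd.
Qed.

Lemma classC_opp k f : of_class_C k f -> of_class_C k (fun x => - f x).
Proof.
elim: k f => [|k IH] f Cf; first exact: continuousP_opp.
apply: (@classC_intro _ _ (fun l x => - pd l f x)) => [l x||l].
- by apply: is_derive_opp; apply: classC_is_derive; eassumption.
- by apply: continuousP_opp; apply: classC_continuous; eassumption.
- by apply: IH; exact: classC_pd.
Qed.

Lemma classC_mul k f g : of_class_C k f -> of_class_C k g ->
  of_class_C k (fun x => f x * g x).
Proof.
elim: k f g => [|k IH] f g Cf Cg; first exact: continuousP_mul.
apply: (@classC_intro _ _ (fun l x => pd l f x * g x + f x * pd l g x)) => [l x||l].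
- by apply: is_derive_mul; apply: classC_is_derive; eassumption.
- by apply: continuousP_mul; apply: classC_continuous; eassumption.
- by apply: classC_add; apply: IH; do ?[exact: classC_pred|exact: classC_pd].
Qed.

Lemma classC_inv k f : of_class_C k f -> (forall x, f x != 0) ->
  of_class_C k (fun x => (f x)^-1).
Proof.
move=> + f0; elim: k => [|k IH] Cf; first exact: continuousP_inv.
have Cf' := classC_pred Cf.
apply: (@classC_intro _ _ (fun l x => - pd l f x * ((f x)^-1 * (f x)^-1))) => [l x||l].
- rewrite -invfM -expr2; apply: is_derive_inv => //.
  by apply: classC_is_derive; eassumption.
- by apply: continuousP_inv => //; apply: classC_continuous; eassumption.
- apply: classC_mul; first by apply: classC_opp; exact: classC_pd.
  by apply: classC_mul; exact: IH.
Qed.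

Lemma classC_exp k f : of_class_C k f -> of_class_C k (fun x => expR (f x)).
Proof.
have ce : of_class_C k f -> continuous (fun x => expR (f x)).
  move=> /classC_continuous cf.
  by apply: (continuousP_comp cf); exact: continuous_expR.
elim: k ce => [|k IH] ce Cf; first exact: ce.
apply: (@classC_intro _ _ (fun l x => expR (f x) * pd l f x)) => [l x||l].
- by apply: is_derive_exp; apply: classC_is_derive; eassumption.
- exact: ce.
- apply: classC_mul; last exact: classC_pd.
  by apply: IH => [_|]; [exact: ce|exact: classC_pred].
Qed.

Lemma classC_sum k m (F : 'I_m -> 'rV[R]_n.+1 -> R) :
  (forall i, of_class_C k (F i)) -> of_class_C k (fun x => \sum_i F i x).
Proof.
elim: m F => [|m IH] F CF.
  by under eq_fun do rewrite big_ord0; exact: classC_cst.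
under eq_fun do rewrite big_ord_recl.
by apply: classC_add => //; apply: IH.
Qed.

(** The derivative along [l] gives back [f], and the other derivatives pass under the integral,
    where the induction hypothesis applies to the partial derivatives of [f]. *)
Lemma classC_primc k l f : of_class_C k f -> of_class_C k (primc l f).
Proof.
elim: k f => [|k IH] f Cf; first exact: continuous_primc.
have cf := classC_continuous Cf.
apply: (@classC_intro _ _ (fun j => if j == l then f else primc l (pd j f))) => [j x||j].
- case: eqVneq => [->|jl]; first exact: is_derive_primc.
  apply: (@is_derive_primc_other _ _ _ _ f (fun j => pd j f)) => // [i y|i].
    by apply: classC_is_derive; eassumption.
  by apply: classC_continuous (classC_pd _ Cf).
- exact: continuous_primc.
- by case: eqP => _; [exact: classC_pred|apply: IH; exact: classC_pd].
Qed.

End ClassC.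

Section ClassCComp.
Context {R : realType} {m n : nat}.

Lemma classC_comp k (f : 'rV[R]_m.+1 -> R) (phi : 'I_m.+1 -> 'rV[R]_n.+1 -> R) :
  of_class_C k f -> (forall j, of_class_C k (phi j)) ->
  of_class_C k (fun x => f (\row_j phi j x)).
Proof.
have cc k' g : of_class_C k' g -> (forall j, of_class_C k' (phi j)) ->
    continuous (fun x => g (\row_j phi j x)).
  move=> Cg Cphi.
  have c := continuous_row (fun j => classC_continuous (Cphi j)).
  exact: (continuousP_comp c (classC_continuous Cg)).
elim: k f => [|k IH] f Cf Cphi; first exact: (cc 0%N).
apply: (@classC_intro _ _ _ _ (fun l x =>
    \sum_j pd j f (\row_j phi j x) * pd l (phi j) x)) => [l x||l].
- apply: (@is_derive_comp _ _ _ f (fun j => pd j f)) => // [i y|i|j].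
  + by apply: classC_is_derive; eassumption.
  + by apply: classC_continuous (classC_pd _ Cf).
  + by apply: classC_is_derive; exact: Cphi.
- exact: cc Cf Cphi.
- apply: classC_sum => j; apply: classC_mul.
    by apply: (IH (pd j f)) => [|i]; [exact: classC_pd|apply: classC_pred; exact: Cphi].
  by apply: classC_pd; exact: Cphi.
Qed.

End ClassCComp.

(** * Flows of scalar differential equations *)

Section GeometricLimits.
Context {R : realType}.

Lemma le_geometric_eq0 (a c : R) : (forall k, `|a| <= c / 2 ^+ k) -> a = 0.
Proof.
move=> H; apply/eqP; rewrite -normr_le0 leNgt; apply/negP => a0.
have c0 : 0 <= c by have := H 0%N; rewrite expr0 divr1; lra.
pose k := Num.bound (c / `|a|).
have ck : c / `|a| < k%:R.
  by apply: archi_boundP; rewrite divr_ge0.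
have k2 : k%:R <= 2 ^+ k :> R by rewrite -natrX ler_nat ltnW // ltn_expl.
have := H k; rewrite leNgt ltr_pdivrMr ?exprn_gt0 //.
by rewrite -ltr_pdivrMl // mulrC (lt_le_trans ck k2).
Qed.

(** The intervals of radius 2c / 2^k around [u k], the tail of the geometric series, are nested; the
    limit is the supremum of their left ends. The explicit rate is what later makes convergence
    locally uniform. *)
Lemma geometric_limit (u : nat -> R) (c : R) :
  (forall k, `|u k.+1 - u k| <= c / 2 ^+ k) ->
  exists a, forall k, `|u k - a| <= 2 * c / 2 ^+ k.
Proof.
move=> H; pose d k := 2 * c / 2 ^+ k.
have dS k : d k.+1 = d k - c / 2 ^+ k.
  have p0 : 2 ^+ k != 0 :> R by rewrite expf_neq0 // pnatr_eq0.
  by rewrite /d exprS; field.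
have d0 k : 0 <= d k.
  have := H k; have := normr_ge0 (u k.+1 - u k) => h1 h2.
  by rewrite /d -mulrA mulr_ge0 //; lra.
have up j k : (j <= k)%N -> u j - d j <= u k - d k.
  move=> /subnK <-; elim: (k - j)%N => [|i IH]; first by rewrite add0n.
  rewrite addSn dS; have := H (i + j)%N; rewrite ler_norml; lra.
have dn j k : (j <= k)%N -> u k + d k <= u j + d j.
  move=> /subnK <-; elim: (k - j)%N => [|i IH]; first by rewrite add0n.
  rewrite addSn dS; have := H (i + j)%N; rewrite ler_norml; lra.
have ud j k : u j - d j <= u k + d k.
  case: (leqP j k) => [/up|/ltnW/dn]; [have := d0 k|have := d0 j]; lra.
pose S := range (fun k => u k - d k).
have Sub k : ubound S (u k + d k) by move=> _ [j _ <-].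
have hS : has_sup S.
  by split; [exists (u 0%N - d 0%N); exists 0%N|exists (u 0%N + d 0%N)].
exists (sup S) => k; rewrite -/(d k).
have : u k - d k <= sup S by apply: sup_upper_bound => //; exists k.
have : sup S <= u k + d k by apply: ge_sup; [case: hS|].
rewrite ler_norml; lra.
Qed.

(* Integrating against the weight [expR (lam * `|r|)] gains the factor
   [lam^-1], which makes the Picard iteration contract on the whole line. *)
Lemma prim_weighted (f g : R -> R) (c lam s : R) :
  continuous f -> continuous g -> 0 < lam ->
  (forall r, `|f r - g r| <= c * expR (lam * `|r|)) ->
  `|prim f s - prim g s| <= c / lam * expR (lam * `|s|).
Proof.
move=> + + lam0; have main (f1 g1 : R -> R) : continuous f1 -> continuous g1 ->
    (forall r, `|f1 r - g1 r| <= c * expR (lam * `|r|)) ->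
    prim f1 s - prim g1 s <= c / lam * expR (lam * `|s|).
  move=> cf cg H.
  have c0 : 0 <= c by have := le_trans (normr_ge0 _) (H 0); rewrite normr0 mulr0 expR0 mulr1.
  pose sg : R := if 0 <= s then 1 else -1.
  have sgE r : between 0 s r -> `|r| = sg * r.
    rewrite /between /sg; case: (leP 0 s) => s0 /andP[r1 r2].
      by rewrite mul1r ger0_norm.
    by rewrite mulN1r ler0_norm.
  have sgs : 0 <= sg * s by rewrite /sg; case: (leP 0 s) => ?; lra.
  have bs : between 0 s s by rewrite /between ge_min le_max !lexx !orbT.
  (* The exponential is chosen so that its derivative along the direction from 0 to [s] is exactly
     the assumed bound. Hence [psi] does not decrease on the way from 0 to [s], and it starts from c
     / lam, which is nonnegative. *)
  pose psi r := c / lam * expR (lam * sg * r) - (prim f1 r - prim g1 r).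
  have dpsi r : between 0 s r ->
      is_derive r 1 psi (c * sg * expR (lam * `|r|) - (f1 r - g1 r)).
    move=> rs; apply: is_derive_value (is_derive_sub
      (is_derive_mul (is_derive_const r 1 (c / lam))
         (is_derive_exp (is_derive_mul (is_derive_const r 1 (lam * sg)) (is_derive_ident r))))
      (is_derive_sub (is_derive_prim r cf) (is_derive_prim r cg))).
    have -> : lam * `|r| = lam * sg * r by rewrite sgE // mulrA.
    by field; rewrite gt_eqF.
  have [x xs E] := mean_value dpsi.
  have : 0 <= psi s - psi 0.
    rewrite E subr0; have := H x; rewrite ler_norml /sg.
    rewrite /sg in sgs; move: sgs; case: (leP 0 s) => s0 _ /andP[h1 h2].
      by rewrite mulr1; apply: mulr_ge0 => //; lra.
    by rewrite mulrN1; apply: mulr_le0; lra.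
  have : 0 <= c / lam by rewrite divr_ge0 // ltW.
  have -> : lam * `|s| = lam * sg * s by rewrite sgE // mulrA.
  by rewrite /psi !prim0 mulr0 expR0 mulr1; lra.
move=> cf cg H; rewrite ler_norml; apply/andP; split; last exact: main.
rewrite lerNl opprB; apply: main => // r; by rewrite distrC.
Qed.

End GeometricLimits.

Section Flow.
Context {R : realType} {n : nat}.
Variables (w : 'rV[R]_n.+1 -> R) (l m : 'I_n.+1) (B L : R).
Hypothesis w_smooth : smooth w.
Hypothesis w_bounded : forall x, `|w x| <= B.
Hypothesis pdw_bounded : forall x, `|pd m w x| <= L.
Implicit Types (Y : 'rV[R]_n.+1 -> R) (x : 'rV[R]_n.+1).

(** The unknown [Y] of the flow is the displacement of a characteristic in coordinate [m], the
    coordinate [l] being time and the others parameters; it vanishes at time 0. *)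
Definition displace Y x := upd m x (x ord0 m + Y x).

Lemma continuous_displace (g : 'rV[R]_n.+1 -> R) Y :
  continuous g -> continuous Y -> continuous (fun x => g (displace Y x)).
Proof.
move=> cg cY; apply: (@continuousP_comp _ _ _ (displace Y) g _ cg).
apply: continuous_upd; first by move=> x; exact: cvg_id.
by apply: continuousP_add => //; exact: coord_continuous.
Qed.

Lemma classC_displace k (g : 'rV[R]_n.+1 -> R) Y :
  of_class_C k g -> of_class_C k Y -> of_class_C k (fun x => g (displace Y x)).
Proof.
move=> Cg CY.
have -> : (fun x => g (displace Y x)) = (fun x => g (\row_j
    (if j == m then x ord0 m + Y x else x ord0 j))).
  by apply/funext => x; congr g; apply/rowP => j; rewrite updE !mxE.
apply: (@classC_comp _ _ _ _ g
  (fun j x => if j == m then x ord0 m + Y x else x ord0 j) Cg) => j.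
case: (j == m); last exact: classC_coord.
by apply: classC_add => //; exact: classC_coord.
Qed.

Lemma lipschitz_displace Y Z x :
  `|w (displace Y x) - w (displace Z x)| <= L * `|Y x - Z x|.
Proof.
have dw r : between (x ord0 m + Z x) (x ord0 m + Y x) r ->
    is_derive r 1 (fun r => w (upd m x r)) (pd m w (upd m x r)).
  by move=> _; apply/is_derive_line; exact: (classC_is_derive m (upd m x r) (w_smooth 1)).
have := mean_value_bound dw (fun r _ => pdw_bounded _).
by have -> : x ord0 m + Y x - (x ord0 m + Z x) = Y x - Z x by ring.
Qed.

(** With this weight the contraction factor L / lam is at most 1/2; the added 1 keeps [lam] positive
    when L = 0. The constant [C] is what bounds the first Picard step: B |x_l| is at most C times
    the weight. *)
Let lam : R := 2 * (L + 1).
Let C : R := B / lam.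

Let L0 : 0 <= L.
Proof. exact: le_trans (normr_ge0 _) (pdw_bounded 0). Qed.

Let B0 : 0 <= B.
Proof. exact: le_trans (normr_ge0 _) (w_bounded 0). Qed.

Let lam0 : 0 < lam.
Proof. by rewrite /lam; have := L0; lra. Qed.

Let W Y x := w (displace Y x).

Let continuous_W Y : continuous Y -> continuous (W Y).
Proof. exact: continuous_displace (classC_continuous (w_smooth 0)). Qed.

(** One Picard step halves the distance in the weighted supremum norm, whatever the length of the
    time interval. *)
Let primcW_dist Y Z c x : continuous Y -> continuous Z ->
  (forall x, `|Y x - Z x| <= c * expR (lam * `|x ord0 l|)) ->
  `|primc l (W Y) x - primc l (W Z) x| <= c / 2 * expR (lam * `|x ord0 l|).
Proof.
move=> cY cZ H; have c0 : 0 <= c.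
  have := le_trans (normr_ge0 _) (H 0).
  by rewrite pmulr_lge0 // expR_gt0.
apply: le_trans (_ : L * c / lam * expR (lam * `|x ord0 l|) <= _).
  apply: (@prim_weighted _ (fun r => W Y (upd l x r)) (fun r => W Z (upd l x r))) => //.
  - by apply: continuous_line; exact: continuous_W.
  - by apply: continuous_line; exact: continuous_W.
  - move=> r; apply: le_trans (lipschitz_displace _ _ _) _.
    rewrite -mulrA; apply: ler_wpM2l; first exact: L0.
    by have := H (upd l x r); rewrite updE eqxx.
rewrite ler_wpM2r ?expR_ge0 // ler_pdivrMr // /lam.
by have := L0; nra.
Qed.

Let picard := fix picard k := if k is k'.+1 then primc l (W (picard k')) else fun=> 0.

Let continuous_picard k : continuous (picard k).
Proof.
elim: k => [|k IH]; first exact: cst_continuous.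
by apply: continuous_primc; exact: continuous_W.
Qed.

Let picard_step k x :
  `|picard k.+1 x - picard k x| <= C / 2 ^+ k * expR (lam * `|x ord0 l|).
Proof.
elim: k x => [|k IH] x.
  rewrite expr0 divr1 subr0.
  have b r : between 0 (x ord0 l) r -> `|W (picard 0) (upd l x r)| <= B.
    by move=> _; exact: w_bounded.
  apply: le_trans (prim_bound _ b) _.
    by apply: continuous_line; exact: continuous_W.
  have := expR_ge1Dx (lam * `|x ord0 l|) => h.
  rewrite /C -mulrA; apply: ler_wpM2l; first exact: B0.
  by rewrite -ler_pdivrMl ?invr_gt0 // invrK; lra.
have -> : C / 2 ^+ k.+1 = C / 2 ^+ k / 2.
  by rewrite exprS invfM; ring.
exact: (primcW_dist x (@continuous_picard k.+1) (@continuous_picard k) IH).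
Qed.

(** The iterates converge pointwise at a geometric rate whose constant depends on x_l only, through
    the weight. The rate is thus locally uniform, which gives continuity of the limit, and
    contraction identifies the limit as a fixed point. *)
Lemma flow_continuous : exists2 Y, continuous Y &
  forall x, Y x = primc l (fun x => w (displace Y x)) x.
Proof.
pose E x := expR (lam * `|x ord0 l|).
have E0 x : 0 < E x := expR_gt0 _.
have /choice[Y HY] x : exists a, forall k, `|picard k x - a| <= 2 * (C * E x) / 2 ^+ k.
  apply: geometric_limit => k; apply: le_trans (picard_step k x) _.
  by rewrite le_eqVlt; apply/orP; left; apply/eqP; rewrite /E; ring.
have cY : continuous Y.
  move=> x0; apply/(@cvgrPdist_le _ _ _ (nbhs x0) (nbhs_filter x0)) => /= e e0.
  (* The error constant at every point whose coordinate [l] is at most |x0_l| + 1 in absolute value;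
     an index [k] making M / 2^k at most e / 3 then serves a whole neighbourhood in a three-term
     estimate. *)
  pose M := 2 * (C * expR (lam * (`|x0 ord0 l| + 1))).
  have M0 : 0 <= M.
    by rewrite /M !mulr_ge0 ?expR_ge0 // invr_ge0 ltW.
  have [k Mk] : exists k, M / 2 ^+ k <= e / 3.
    pose k := Num.bound (M / (e / 3)); exists k.
    have e30 : 0 < e / 3 by lra.
    have ck : M / (e / 3) < k%:R by apply: archi_boundP; rewrite divr_ge0 // ltW.
    have k2 : k%:R <= 2 ^+ k :> R by rewrite -natrX ler_nat ltnW // ltn_expl.
    rewrite ler_pdivrMr ?exprn_gt0 // mulrC -ler_pdivrMr //.
    exact: ltW (lt_le_trans ck k2).
  have /(@cvgrPdist_le _ _ _ (nbhs x0) (nbhs_filter x0)) /(_ (e / 3)) nk := @continuous_picard k x0.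
  have /(@cvgrPdist_le _ _ _ (nbhs x0) (nbhs_filter x0)) /(_ 1 ltr01) nl :=
    @coord_continuous R 1 n.+1 ord0 l x0.
  have e30 : 0 < e / 3 by lra.
  near=> x.
  have h1 : `|picard k x0 - picard k x| <= e / 3 by near: x; exact: nk.
  have h2 : `|x0 ord0 l - x ord0 l| <= 1 by near: x; exact: nl.
  have bd (y : 'rV[R]_n.+1) : `|y ord0 l| <= `|x0 ord0 l| + 1 -> `|picard k y - Y y| <= e / 3.
    move=> yl; apply: le_trans (HY y k) _; apply: le_trans Mk.
    rewrite ler_wpM2r ?invr_ge0 ?exprn_ge0 // /M ler_wpM2l // ler_wpM2l //.
      by rewrite /C divr_ge0 // ltW.
    by rewrite ler_expR ler_wpM2l // ltW.
  have b0 : `|picard k x0 - Y x0| <= e / 3 by apply: bd; lra.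
  have b1 : `|picard k x - Y x| <= e / 3.
    apply: bd; have -> : x ord0 l = x0 ord0 l - (x0 ord0 l - x ord0 l) by ring.
    by apply: le_trans (ler_normB _ _) _; lra.
  have -> : Y x0 - Y x = (picard k x0 - picard k x) - (picard k x0 - Y x0) +
    (picard k x - Y x) by ring.
  apply: le_trans (ler_normD _ _) _.
  have := ler_normB (picard k x0 - picard k x) (picard k x0 - Y x0); lra.
exists Y => // x.
(* Both [Y] and its Picard image are compared with [picard k.+1]. Each comparison costs half of the
   stated bound: one by convergence, the other by contraction. *)
apply/subr0_eq; apply: (@le_geometric_eq0 _ _ (2 * (C * E x))) => k.
have p0 : 2 ^+ k != 0 :> R by rewrite expf_neq0 // pnatr_eq0.
have c (y : 'rV[R]_n.+1) : `|picard k y - Y y| <= (2 * C / 2 ^+ k) * E y.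
  apply: le_trans (HY y k) _.
  by rewrite le_eqVlt; apply/orP; left; apply/eqP; ring.
have h1 := primcW_dist x (@continuous_picard k) cY c.
have h2 := HY x k.+1.
have -> : Y x - primc l (fun x => w (displace Y x)) x =
   (picard k.+1 x - primc l (W Y) x) - (picard k.+1 x - Y x).
  by rewrite /W; ring.
apply: le_trans (ler_normB _ _) _.
have -> : 2 * (C * E x) / 2 ^+ k =
  2 * C / 2 ^+ k / 2 * E x + 2 * (C * E x) / 2 ^+ k.+1.
  by rewrite exprS; field.
by apply: lerD.
Unshelve. all: by end_near. Qed.
End Flow.

Section LinearODE.
Context {R : realType}.

Lemma continuous_prim1 (f : R -> R) : continuous f -> continuous (prim f).
Proof. by move=> cf r; apply: is_derive_continuous (is_derive_prim r cf). Qed.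

(** Variation of constants with zero initial value. The factor [h] is kept outside, so that dividing
    by it leaves an expression that makes sense at h = 0; the case h = 0 itself is uniqueness for
    the homogeneous equation. *)
Lemma linear_ode (y alpha beta : R -> R) (h s : R) :
  continuous alpha -> continuous beta ->
  (forall r : R, is_derive r 1 y (h * alpha r + beta r * y r)) -> y 0 = 0 ->
  y s = h * (expR (prim beta s) * prim (fun r => expR (- prim beta r) * alpha r) s).
Proof.
move=> ca cb dy y0; pose E r := expR (- prim beta r).
have cE : continuous (fun r => E r * alpha r).
  apply: continuousP_mul => //.
  apply: (continuousP_comp (continuousP_opp (continuous_prim1 cb))).
  exact: continuous_expR.
suff H : y s * E s = h * prim (fun r => E r * alpha r) s.
  rewrite mulrCA -H mulrCA /E -expRD subrr expR0 mulr1 //.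
apply: (@is_derive_eq_between _ (fun s => y s * E s)
  (fun s => h * prim (fun r => E r * alpha r) s) (fun r => h * (E r * alpha r)) 0 s)
  => [r _|r _|].
- apply: is_derive_value (is_derive_mul (dy r)
    (is_derive_exp (is_derive_opp (is_derive_prim r cb)))).
  by rewrite -/(E r); ring.
- apply: is_derive_value (is_derive_mul (is_derive_const (r : R) 1 h) (is_derive_prim r cE)).
  by rewrite mul0r add0r.
- by rewrite y0 mul0r prim0 mulr0.
Qed.
End LinearODE.

Section FlowSmooth.
Context {R : realType} {n : nat}.
Variables (w Y : 'rV[R]_n.+1 -> R) (l m : 'I_n.+1).
Hypothesis w_smooth : smooth w.
Hypothesis cY : continuous Y.
Hypothesis YE : forall x, Y x = primc l (fun x => w (displace m Y x)) x.
Implicit Types (x : 'rV[R]_n.+1) (j : 'I_n.+1).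

Let continuous_shift (g : 'rV[R]_n.+1 -> R) :
  continuous g -> continuous (fun x => g (displace m Y x)).
Proof. by move=> cg; apply: continuous_displace. Qed.

Let is_derive_flow x : is_derive x (basis_vec l) Y (w (displace m Y x)).
Proof.
have E : primc l (fun x => w (displace m Y x)) = Y.
  by apply/funext => y; rewrite -YE.
have := is_derive_primc l x (continuous_shift (classC_continuous (w_smooth 0))).
by rewrite E.
Qed.

Let flow0 x : x ord0 l = 0 -> Y x = 0.
Proof. by move=> x0; rewrite YE primc0. Qed.

(** The solution, zero on x_l = 0, of the equation linearised along the flow, Z' = d_j w + (d_m w)
    Z. Only [Y] occurs in it, not its derivatives. *)
Let dY j : 'rV[R]_n.+1 -> R :=
  let b := primc l (fun x => pd m w (displace m Y x)) in
  fun x => expR (b x) * primc l (fun x => expR (- b x) * pd j w (displace m Y x)) x.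

(* By Hadamard's lemma the increment [Y (x + h e_j) - Y x] solves along the
   [l]-axis a linear equation with coefficients continuous up to [h = 0], so
   [linear_ode] exhibits the difference quotient as a continuous function of
   [h]. *)
Let is_derive_flow_other j x : j != l -> is_derive x (basis_vec j) Y (dY j x).
Proof.
move=> jl.
have [A [cA EA A1]] := hadamard (fun j y => classC_is_derive j y (w_smooth 1))
  (fun j => classC_continuous (classC_pd j (w_smooth 1))).
pose e : 'rV[R]_n.+1 := basis_vec j.
pose z (h r : R) : 'rV[R]_n.+1 := upd l (h *: e + x) r.
have c1 : continuous (fun u : R * R => u.1) by move=> u; exact: cvg_fst.
have c2 : continuous (fun u : R * R => u.2) by move=> u; exact: cvg_snd.
have cz : continuous (fun u : R * R => z u.1 u.2).
  apply: continuous_upd => //.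
  under eq_fun do rewrite upd_line.
  apply: continuous_upd; first exact: cst_continuous.
  by apply: continuousP_add => //; exact: cst_continuous.
have cz0 : continuous (fun u : R * R => z 0 u.2).
  exact: continuous_upd (@cst_continuous _ _ (0 *: e + x)) c2.
pose q i (h r : R) := A i (displace m Y (z 0 r)) (displace m Y (z h r)).
have cD : continuous (displace m Y).
  apply: continuous_upd; first by move=> y; exact: cvg_id.
  by apply: continuousP_add => //; exact: coord_continuous.
have cq i : continuous (fun u : R * R => q i u.1 u.2).
  exact: (@continuousP_comp _ _ _ (fun u : R * R =>
    (displace m Y (z 0 u.2), displace m Y (z u.1 u.2))) (fun u => A i u.1 u.2)
    (continuousP_pair (continuousP_comp cz0 cD) (continuousP_comp cz cD)) (cA i)).
pose s := x ord0 l.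
pose b h r := prim (q m h) r.
have cb : continuous (fun u : R * R => b u.1 u.2) := continuous_prim (cq m).
pose F h r := expR (- b h r) * q j h r.
have cF : continuous (fun u : R * R => F u.1 u.2).
  apply: continuousP_mul; last exact: cq.
  by apply: (continuousP_comp (continuousP_opp cb)); exact: continuous_expR.
pose Z h := expR (b h s) * prim (F h) s.
have cZ : continuous Z.
  have cs : continuous (fun h : R => (h, s)).
    by apply: continuousP_pair; [move=> h; exact: cvg_id|exact: cst_continuous].
  apply: continuousP_mul.
    apply: (continuousP_comp (continuousP_comp cs cb)); exact: continuous_expR.
  exact: (continuousP_comp cs (continuous_prim cF)).
have ZE h : Y (h *: e + x) - Y x = h * Z h.
  pose y r := Y (z h r) - Y (z 0 r).
  have -> : Y (h *: e + x) - Y x = y s.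
    rewrite /y /z scale0r add0r /s upd_same.
    by rewrite -{1}(upd_same l (h *: e + x)) upd_line updE eq_sym (negbTE jl).
  apply: (@linear_ode _ y (q j h) (q m h) h s).
  - exact: (@continuous_pairl _ _ (q j) h (cq j)).
  - exact: (@continuous_pairl _ _ (q m) h (cq m)).
  - move=> r; apply: is_derive_value (is_derive_sub
      ((is_derive_line _ _ _ _ _).1 (is_derive_flow (z h r)))
      ((is_derive_line _ _ _ _ _).1 (is_derive_flow (z 0 r)))).
    rewrite EA.
    (* The two displaced points differ by [h] in coordinate [j] and by [y r] in coordinate [m]; when
       j = m the contributions add up. They yield the source term and the linear term of the
       equation. *)
    have D i : displace m Y (z h r) ord0 i - displace m Y (z 0 r) ord0 i =
        (i == j)%:R * h + (i == m)%:R * y r.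
      rewrite /displace !(updE m) /y; case: eqVneq => [->|_]; rewrite /z !(updE l) !mxE eqxx /=;
        case: eqVneq => [E|_]; rewrite ?E ?[l == j]eq_sym ?(negbTE jl) ?mulr0 ?mul0r;
        ring.
    transitivity (\sum_i ((i == j)%:R * (A i (displace m Y (z 0 r)) (displace m Y (z h r)) * h) +
      (i == m)%:R * (A i (displace m Y (z 0 r)) (displace m Y (z h r)) * y r))).
      by apply: eq_bigr => i _; rewrite D; ring.
    rewrite big_split /= (bigD1 j) //= big1 => [|i /negbTE ->]; last by rewrite mul0r.
    rewrite (bigD1 m) //= big1 => [|i /negbTE ->]; last by rewrite mul0r.
    by rewrite !eqxx !mul1r !addr0 mulrC.
  - by rewrite /y !flow0 ?subrr // /z updE eqxx.
apply/is_deriveP.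
have -> : dY j x = Z 0.
  have z0 r : z 0 r = upd l x r by rewrite /z scale0r add0r.
  have q0 i r : q i 0 r = pd i w (displace m Y (upd l x r)) by rewrite /q A1 z0.
  have b0 r : b 0 r = primc l (fun x => pd m w (displace m Y x)) (upd l x r).
    by rewrite primc_upd /b; congr prim; apply/funext => t; exact: q0.
  rewrite /dY /Z b0 upd_same; congr (_ * prim _ _).
  by apply/funext => r; rewrite /F b0 q0.
have H : Z h @[h --> (0 : R)^'] --> Z 0.
  by apply: cvg_within_filter; exact: cZ.
apply: cvg_trans H; apply: near_eq_cvg; near=> h.
have h0 : h != 0 by near: h; exact: nbhs_dnbhs_neq.
by rewrite ZE mulKf.
Unshelve. all: by end_near. Qed.

Lemma flow_smooth : smooth Y.
Proof.
elim=> [//|k CY].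
have Cw g : smooth g -> of_class_C k (fun x => g (displace m Y x)).
  by move=> sg; apply: classC_displace.
apply: (@classC_intro _ _ _ _ (fun j => if j == l then fun x => w (displace m Y x)
    else dY j)) => [j x||j].
- by case: eqVneq => [->|]; [exact: is_derive_flow|exact: is_derive_flow_other].
- exact: cY.
- have Cb : of_class_C k (primc l (fun x => pd m w (displace m Y x))).
    apply: classC_primc; apply: (Cw (pd m w)) => k'.
    exact: (classC_pd m (w_smooth k'.+1)).
  case: eqP => _; first exact: Cw.
  apply: classC_mul; first exact: classC_exp.
  apply: classC_primc; apply: classC_mul; first by apply: classC_exp; exact: classC_opp.
  by apply: (Cw (pd j w)) => k'; exact: (classC_pd j (w_smooth k'.+1)).
Qed.

End FlowSmooth.

Lemma flow {R : realType} {n : nat} (w : 'rV[R]_n.+1 -> R) (l m : 'I_n.+1) (B L : R) :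
  smooth w -> (forall x, `|w x| <= B) -> (forall x, `|pd m w x| <= L) ->
  exists Y : 'rV[R]_n.+1 -> R, [/\ smooth Y, forall x : 'rV[R]_n.+1, x ord0 l = 0 -> Y x = 0
    & forall x, is_derive x (basis_vec l) Y (w (displace m Y x))].
Proof.
move=> sw wB wL; have [Y cY YE] := flow_continuous l sw wB wL.
exists Y; split.
- exact: flow_smooth sw cY YE.
- by move=> x x0; rewrite YE primc0.
- move=> x; have cw : continuous (fun x => w (displace m Y x)).
    by apply: continuous_displace cY; exact: classC_continuous (sw 0).
  have E : primc l (fun x => w (displace m Y x)) = Y by apply/funext => y; rewrite -YE.
  by have := is_derive_primc l x cw; rewrite E.
Qed.

(** * Smooth functions *)

Section Smooth.
Context {R : realType} {n : nat}.
Implicit Types (f g : 'rV[R]_n.+1 -> R).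

Lemma smooth_is_derive f l x : smooth f -> is_derive x (basis_vec l) f (pd l f x).
Proof. by move=> sf; exact: classC_is_derive (sf 1). Qed.

Lemma smooth_continuous f : smooth f -> continuous f.
Proof. by move=> sf; exact: classC_continuous (sf 0). Qed.

Lemma smooth_pd f l : smooth f -> smooth (pd l f).
Proof. by move=> sf k; exact: classC_pd (sf k.+1). Qed.

Lemma smooth_cst (c : R) : smooth (fun _ : 'rV[R]_n.+1 => c).
Proof. by move=> k; exact: classC_cst. Qed.

Lemma smooth_coord j : smooth (fun x : 'rV[R]_n.+1 => x ord0 j).
Proof. by move=> k; exact: classC_coord. Qed.

Lemma smooth_add f g : smooth f -> smooth g -> smooth (fun x => f x + g x).
Proof. by move=> sf sg k; apply: classC_add. Qed.

Lemma smooth_opp f : smooth f -> smooth (fun x => - f x).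
Proof. by move=> sf k; apply: classC_opp. Qed.

Lemma smooth_sub f g : smooth f -> smooth g -> smooth (fun x => f x - g x).
Proof. by move=> sf sg; apply: smooth_add => //; exact: smooth_opp. Qed.

Lemma smooth_mul f g : smooth f -> smooth g -> smooth (fun x => f x * g x).
Proof. by move=> sf sg k; apply: classC_mul. Qed.

Lemma smooth_inv f : smooth f -> (forall x, f x != 0) -> smooth (fun x => (f x)^-1).
Proof. by move=> sf f0 k; apply: classC_inv. Qed.

Lemma smooth_exp f : smooth f -> smooth (fun x => expR (f x)).
Proof. by move=> sf k; apply: classC_exp. Qed.

Lemma smooth_primc l f : smooth f -> smooth (primc l f).
Proof. by move=> sf k; apply: classC_primc. Qed.

Lemma smooth_displace m f g : smooth f -> smooth g -> smooth (fun x => f (displace m g x)).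
Proof. by move=> sf sg k; apply: classC_displace. Qed.

Lemma smooth_prod (I : Type) (s : seq I) (F : I -> 'rV[R]_n.+1 -> R) :
  (forall i, smooth (F i)) -> smooth (fun x => \prod_(i <- s) F i x).
Proof.
move=> sF; elim: s => [|i s IH].
  by under eq_fun do rewrite big_nil; exact: smooth_cst.
by under eq_fun do rewrite big_cons; exact: smooth_mul.
Qed.

End Smooth.

Lemma smooth_comp {R : realType} {m n : nat} (f : 'rV[R]_m.+1 -> R)
    (phi : 'I_m.+1 -> 'rV[R]_n.+1 -> R) :
  smooth f -> (forall j, smooth (phi j)) -> smooth (fun x => f (\row_j phi j x)).
Proof. by move=> sf sphi k; apply: classC_comp => // j; exact: sphi. Qed.

(** * A smooth step function built from exp(-1/t) *)

Section SmoothStep.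
Context {R : realType}.

(* The derivatives of [expR (- t^-1)], extended by [0] to [t <= 0], are
   combinations of the members of this family. *)
Definition flat k (t : R) : R := if 0 < t then t^-1 ^+ k * expR (- t^-1) else 0.

(** With s = 1/t this is the inequality s^(k+1) / (k+1)! <= exp s. A bound linear in [t] suffices
    for continuity at 0. *)
Lemma flat_bound k t : `|flat k t| <= k.+1`!%:R * `|t|.
Proof.
rewrite /flat; case: ltP => t0; last by rewrite normr0 mulr_ge0.
have s0 : 0 < t^-1 by rewrite invr_gt0.
rewrite !gtr0_norm ?mulr_gt0 ?exprn_gt0 ?expR_gt0 // expRN.
rewrite -ler_pdivlMr ?invr_gt0 ?expR_gt0 // invrK.
rewrite mulrAC -ler_pdivrMr // -exprSr mulrC -ler_pdivrMr ?ltr0n ?fact_gt0 //.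
by apply: le_trans (expR_ge1Dxn k (ltW s0)); rewrite lerDr.
Qed.

Lemma flat_le0 k t : t <= 0 -> flat k t = 0.
Proof. by rewrite /flat ltNge => ->. Qed.

Lemma flat_continuous0 k : flat k @ (0 : R) --> (0 : R).
Proof.
apply/cvgrPdist_le => /= e e0.
pose M : R := k.+1`!%:R.
have M0 : 0 < M by rewrite ltr0n fact_gt0.
exists (e / M); first by rewrite /= divr_gt0.
move=> t /=; rewrite sub0r normrN => tM.
rewrite sub0r normrN (le_trans (flat_bound k t)) // -/M mulrC -ler_pdivlMr //.
exact: ltW.
Qed.

Lemma is_derive_invX k (t : R) : t != 0 ->
  is_derive t 1 (fun t => t^-1 ^+ k) (- k%:R * t^-1 ^+ k.+1).
Proof.
move=> t0; elim: k => [|k IH].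
  rewrite oppr0 mul0r; under eq_fun do rewrite expr0; exact: is_derive_const.
under eq_fun do rewrite exprSr.
apply: is_derive_value (is_derive_mul IH (is_derive_inv t0 (is_derive_ident t))).
by rewrite -(natr1 k) !exprSr; field.
Qed.

Lemma is_derive_flat k (t : R) :
  is_derive t 1 (flat k) (- k%:R * flat k.+1 t + flat k.+2 t).
Proof.
case: (ltgtP t 0) => [t0|t0|->].
- rewrite !flat_le0 ?ltW // mulr0 addr0.
  have N : \forall s \near t, (fun=> 0) s = flat k s.
    have : \forall s \near t, s < 0 by exact: lt_nbhsl.
    by apply: filterS => s s0; rewrite flat_le0 // ltW.
  exact: near_eq_is_derive N (is_derive_const t 1 0).
- have N : \forall s \near t, (fun s => s^-1 ^+ k * expR (- s^-1)) s = flat k s.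
    have : \forall s \near t, 0 < s by exact: lt_nbhsr.
    by apply: filterS => s s0; rewrite /flat s0.
  have tn0 : t != 0 by rewrite gt_eqF.
  apply: (near_eq_is_derive N).
  apply: is_derive_value (is_derive_mul (is_derive_invX k tn0)
    (is_derive_exp (is_derive_opp (is_derive_inv tn0 (is_derive_ident t))))).
  by rewrite /flat t0 !exprSr; field.
(* At 0 the difference quotient of [flat k] is [flat k.+1], whose limit is already known to be 0. *)
- rewrite !flat_le0 // mulr0 addr0; apply/is_deriveP.
  have H : flat k.+1 h @[h --> (0 : R)^'] --> (0 : R).
    by apply: cvg_within_filter; exact: flat_continuous0.
  apply: cvg_trans H; apply: near_eq_cvg; near=> h.
  have h0 : h != 0 by near: h; exact: nbhs_dnbhs_neq.
  rewrite addr0 [h *: 1]mulr1 (flat_le0 k (lexx 0)) subr0 /flat.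
  by case: ifP => _; rewrite ?mulr0 // exprS mulrA.
Unshelve. all: by end_near. Qed.

(** The family is closed under differentiation up to linear combinations, so the induction on the
    order of differentiability runs over all [k] at once. *)
Lemma smooth_flat n k (phi : 'rV[R]_n.+1 -> R) :
  smooth phi -> smooth (fun x => flat k (phi x)).
Proof.
move=> sphi K; elim: K k => [|K IH] k.
  apply: (continuousP_comp (smooth_continuous sphi)) => t.
  exact: is_derive_continuous (is_derive_flat k t).
apply: (@classC_intro _ _ _ _ (fun l x =>
  (- k%:R * flat k.+1 (phi x) + flat k.+2 (phi x)) * pd l phi x)) => [l x||l].
- by apply: is_derive_comp1; [exact: is_derive_flat|exact: smooth_is_derive].
- apply: (continuousP_comp (smooth_continuous sphi)) => t.
  exact: is_derive_continuous (is_derive_flat k t).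
- apply: classC_mul; last exact: smooth_pd.
  apply: classC_add; last exact: IH.
  by apply: classC_mul; [exact: classC_cst|exact: IH].
Qed.

Definition smooth_step (a b t : R) : R :=
  flat 0 (t - a) / (flat 0 (t - a) + flat 0 (b - t)).

Lemma flat0_ge0 t : 0 <= flat 0 t.
Proof. by rewrite /flat; case: ifP => // _; rewrite mulr_ge0 ?expR_ge0. Qed.

Lemma flat0_gt0 t : 0 < t -> 0 < flat 0 t.
Proof. by rewrite /flat => ->; rewrite expr0 mul1r expR_gt0. Qed.

(** As a < b, either t > a or t < b, so one of the two nonnegative summands is positive. *)
Lemma smooth_step_den a b t : a < b -> 0 < flat 0 (t - a) + flat 0 (b - t).
Proof.
move=> ab; have := flat0_ge0 (t - a); have := flat0_ge0 (b - t).
case: (ltP a t) => at_.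
  have : 0 < flat 0 (t - a) by apply: flat0_gt0; lra.
  by lra.
have : 0 < flat 0 (b - t) by apply: flat0_gt0; lra.
by lra.
Qed.

Lemma smooth_step_ge0 a b t : a < b -> 0 <= smooth_step a b t.
Proof. by move=> ab; rewrite divr_ge0 ?flat0_ge0 // ltW // smooth_step_den. Qed.

Lemma smooth_step_le1 a b t : a < b -> smooth_step a b t <= 1.
Proof.
move=> ab; rewrite ler_pdivrMr ?smooth_step_den // mul1r.
by rewrite lerDl flat0_ge0.
Qed.

Lemma smooth_step_left a b t : t <= a -> smooth_step a b t = 0.
Proof. by move=> ta; rewrite /smooth_step flat_le0 ?mul0r // subr_le0. Qed.

Lemma smooth_step_right a b t : a < b -> b <= t -> smooth_step a b t = 1.
Proof.
move=> ab bt; have := smooth_step_den t ab.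
by rewrite /smooth_step (@flat_le0 _ (b - t)) ?subr_le0 // addr0 => h; rewrite divff // gt_eqF.
Qed.

Lemma smooth_smooth_step n a b (phi : 'rV[R]_n.+1 -> R) : a < b ->
  smooth phi -> smooth (fun x => smooth_step a b (phi x)).
Proof.
move=> ab sphi.
have sa : smooth (fun x => flat 0 (phi x - a)).
  by apply: smooth_flat; apply: smooth_sub => //; exact: smooth_cst.
apply: smooth_mul => //; apply: smooth_inv.
  apply: smooth_add => //; apply: smooth_flat.
  by apply: smooth_sub => //; exact: smooth_cst.
by move=> x; rewrite gt_eqF // smooth_step_den.
Qed.

End SmoothStep.

(** * Extending functions off the cube *)

Section Extensions.
Context {R : realType} {n : nat} (delta : R).
Hypothesis delta_gt0 : 0 < delta.
Implicit Types (f g : 'rV[R]_n.+1 -> R) (x : 'rV[R]_n.+1) (l j : 'I_n.+1).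

Lemma box_compact (a b : R) :
  compact [set x : 'rV[R]_n.+1 | forall l, a <= x ord0 l <= b].
Proof.
have := @rV_compact R n.+1 (fun=> `[a, b]%classic) (fun=> @segment_compact R a b).
suff -> : [set v : 'rV[R]_n.+1 | forall i, `[a, b]%classic (v ord0 i)] =
  [set x : 'rV[R]_n.+1 | forall l, a <= x ord0 l <= b] by [].
by apply/seteqP; split=> x /= H l; have := H l; rewrite in_itv.
Qed.

Lemma cube_compact : compact (@cube R n delta).
Proof. exact: box_compact. Qed.

Lemma cube0 : @cube R n delta 0.
Proof. by move=> l; rewrite mxE lexx ltW. Qed.

Lemma bounded_on_box f (a b : R) : continuous f -> a <= b ->
  exists M, forall x, (forall l, a <= x ord0 l <= b) -> `|f x| <= M.
Proof.
move=> cf ab; pose A := [set x : 'rV[R]_n.+1 | forall l, a <= x ord0 l <= b].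
have A0 : A !=set0 by exists (const_mx a) => l; rewrite mxE lexx.
have cn : continuous (fun x => `|f x|).
  by apply: (continuousP_comp cf); exact: norm_continuous.
have [c _ H] := EVT_max_rV A0 (@box_compact a b) (continuous_subspaceT cn).
by exists `|f c| => x xA; apply: H; exact/mem_set.
Qed.

(** An arbitrary smooth extension [F] may change sign off the cube. It is blended with the constant
    [m], its minimum on the cube, by a step in the value of [F] itself: the result is [m] where F <=
    m/2, a convex combination of two numbers above m/2 elsewhere, and [F] where F >= m, in
    particular on the cube. *)
Lemma positive_extension f : smooth_on_cube delta f ->
  (forall x, cube delta x -> 0 < f x) ->
  exists g, [/\ smooth g, forall x, 0 < g x & eq_on_cube delta f g].
Proof.
move=> [F sF fF] f0.
have C0 : @cube R n delta !=set0 by exists 0; exact: cube0.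
have [c /set_mem cC H] := EVT_min_rV C0 cube_compact
  (continuous_subspaceT (smooth_continuous sF)).
pose m := F c; have m0 : 0 < m by rewrite /m -fF //; exact: f0.
have m2 : m / 2 < m by lra.
pose s t := smooth_step (m / 2) m t.
exists (fun x => s (F x) * F x + (1 - s (F x)) * m); split.
- have ss : smooth (fun x => s (F x)) by exact: smooth_smooth_step.
  apply: smooth_add; apply: smooth_mul => //; last exact: smooth_cst.
  by apply: smooth_sub => //; exact: smooth_cst.
- move=> x; have s0 := smooth_step_ge0 (F x) m2; have s1 := smooth_step_le1 (F x) m2.
  case: (leP (F x) (m / 2)) => Fx.
    by rewrite /s smooth_step_left // mul0r add0r subr0 mul1r.
  rewrite -/(s (F x)) in s0 s1.
  have h1 : s (F x) * (m / 2) <= s (F x) * F x by rewrite ler_wpM2l // ltW.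
  have h2 : (1 - s (F x)) * (m / 2) <= (1 - s (F x)) * m.
    by rewrite ler_wpM2l ?subr_ge0 // ltW.
  lra.
- move=> x xC; rewrite fF // /s smooth_step_right // ?mul1r ?subrr ?mul0r ?addr0 //.
  by apply: H; exact/mem_set.
Qed.

Lemma bounded_extension f m : smooth f -> exists g B,
  [/\ smooth g, eq_on_cube delta f g, forall x, `|g x| <= B
    & forall x, `|pd m g x| <= B].
Proof.
move=> sf; pose s t : R := smooth_step (-1) 0 t.
have lt10 : -1 < 0 :> R by lra.
pose K x := \prod_(l < n.+1) (s (x ord0 l) * s (delta - x ord0 l)).
have sK : smooth K.
  apply: smooth_prod => l; apply: smooth_mul; apply: smooth_smooth_step => //.
    exact: smooth_coord.
  by apply: smooth_sub; [exact: smooth_cst|exact: smooth_coord].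
have K1 x : cube delta x -> K x = 1.
  move=> xC; rewrite /K big1 // => l _; have /andP[x0 x1] := xC l.
  by rewrite /s !smooth_step_right ?mul1r // subr_ge0.
have K0 x l : x ord0 l < -1 \/ delta + 1 < x ord0 l -> K x = 0.
  move=> h; rewrite /K (bigD1 l) //= /s.
  by case: h => h; [rewrite smooth_step_left ?mul0r // ltW|
    rewrite [X in _ * X * _]smooth_step_left ?mulr0 ?mul0r //; lra].
pose g x := f x * K x; have sg : smooth g by exact: smooth_mul.
(* The complement of the box is open, so [g] vanishes near each of its points and its derivative
   vanishes there too. *)
have out x : ~ (forall l, -1 <= x ord0 l <= delta + 1) ->
    \forall y \near x, (fun=> 0) y = g y.
  move=> /existsNP[l /negP]; rewrite negb_and -!ltNge => /orP xl.
  have /(_ x) cl := @coord_continuous R 1 n.+1 ord0 l.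
  have : nbhs x [set y : 'rV[R]_n.+1 | y ord0 l < -1 \/ delta + 1 < y ord0 l].
    case: xl => xl.
      by apply: (@filterS _ _ (nbhs_filter x) _ _ _ (cl _ (lt_nbhsl xl))) => y ?; left.
    by apply: (@filterS _ _ (nbhs_filter x) _ _ _ (cl _ (lt_nbhsr xl))) => y ?; right.
  by apply: (@filterS _ _ (nbhs_filter x)) => y yl; rewrite /g (K0 _ l) // mulr0.
have ab : -1 <= delta + 1 by have := delta_gt0; lra.
have [M1 H1] := bounded_on_box (smooth_continuous sg) ab.
have [M2 H2] := bounded_on_box (smooth_continuous (smooth_pd m sg)) ab.
(* Absolute values make the bound visibly nonnegative, which is what the points off the box call
   for. *)
exists g, (Num.max `|M1| `|M2|); split=> //.
- by move=> x xC; rewrite /g K1 // mulr1.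
- move=> x; case: (pselect (forall l, -1 <= x ord0 l <= delta + 1)) => [xb|/out xo].
    by rewrite le_max (le_trans (H1 x xb) (ler_norm M1)).
  by rewrite -(nbhs_singleton xo) normr0 le_max normr_ge0.
- move=> x; case: (pselect (forall l, -1 <= x ord0 l <= delta + 1)) => [xb|/out xo].
    by rewrite le_max (le_trans (H2 x xb) (ler_norm M2)) orbT.
  have /= := near_eq_is_derive xo (is_derive_const x (basis_vec m) 0).
  by move=> /pdE ->; rewrite normr0 le_max normr_ge0.
Qed.

End Extensions.

(** * The transport equation *)

Lemma pd_displace {R : realType} {n : nat} (f Y : 'rV[R]_n.+1 -> R) l m x :
  smooth f -> smooth Y ->
  pd l (fun x => f (displace m Y x)) x =
  pd l f (displace m Y x) + pd m f (displace m Y x) * pd l Y x.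
Proof.
move=> sf sY; pose phi (i : 'I_n.+1) (x : 'rV[R]_n.+1) := x ord0 i + (i == m)%:R * Y x.
have E y : displace m Y y = \row_i phi i y.
  apply/rowP => i; rewrite /displace updE mxE /phi.
  by case: eqVneq => [->|_]; rewrite ?mul1r ?mul0r ?addr0.
have -> : (fun x => f (displace m Y x)) = (fun x => f (\row_i phi i x)).
  by apply/funext => y; rewrite E.
apply: pdE; apply: is_derive_value (is_derive_comp
  (fun i y => smooth_is_derive i y sf)
  (fun i => smooth_continuous (smooth_pd i sf))
  (fun i => is_derive_add (is_derive_basis_coord l i x)
     (is_derive_mul (is_derive_const x _ (i == m)%:R) (smooth_is_derive l x sY)))).
rewrite E (eq_bigr (fun i => (l == i)%:R * pd i f (\row_i phi i x) +
  (i == m)%:R * (pd i f (\row_i phi i x) * pd l Y x))); last by move=> i _; ring.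
rewrite big_split /= (bigD1 l) //= big1 => [|i]; last first.
  by rewrite eq_sym => /negbTE ->; rewrite mul0r.
rewrite (bigD1 m) //= big1 => [|i /negbTE ->]; last by rewrite mul0r.
by rewrite !eqxx !mul1r !addr0.
Qed.

Section MaterialDerivative.
Context {R : realType} {n : nat} (vh : 'rV[R]_n.+1 -> R) (a s m : 'I_n.+1).
Hypothesis vh_s : forall x, is_derive x (basis_vec s) vh 0.
Hypotheses (as_ : a != s) (ms : m != s).
Implicit Types (w f h Y : 'rV[R]_n.+1 -> R) (x y : 'rV[R]_n.+1).

(** Here [a] is time, [s] elapsed time and [m] the transported coordinate. On the diagonal where [a]
    and [s] coincide, the first two terms add up to a single time derivative, so this is the
    transport operator lifted to one more variable. *)
Definition material f x := pd a f x + pd s f x + vh x * pd m f x.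

Lemma pd_primc_other j h x : smooth h -> j != s ->
  pd j (primc s h) x = primc s (pd j h) x.
Proof.
move=> sh js; apply: pdE.
apply: (is_derive_primc_other x (fun i y => smooth_is_derive i y sh)) js.
  by move=> i; exact: smooth_continuous (smooth_pd i sh).
exact: smooth_continuous.
Qed.

Lemma pd_primc h x : smooth h -> pd s (primc s h) x = h x.
Proof.
move=> sh; apply: pdE; apply: is_derive_primc.
exact: smooth_continuous.
Qed.

Lemma materialE h : smooth h -> material (primc s h) =
  (fun x => primc s (pd a h) x + h x + vh x * primc s (pd m h) x).
Proof.
by move=> sh; apply/funext => x; rewrite /material (pd_primc_other x sh as_)
  (pd_primc_other x sh ms) pd_primc.
Qed.

(** The material derivative commutes with d/ds because [vh] does not depend on [s]. Writing the
    function as a primitive in [s] gives the mixed derivatives directly, without exchanging the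
    order of differentiation. *)
Lemma is_derive_material h x : smooth h ->
  is_derive x (basis_vec s) (material (primc s h)) (material h x).
Proof.
move=> sh; rewrite materialE //.
have D j := is_derive_primc s x (smooth_continuous (smooth_pd j sh)).
apply: is_derive_value (is_derive_add (is_derive_add (D a) (smooth_is_derive s x sh))
  (is_derive_mul (vh_s x) (D m))).
by rewrite /material mul0r add0r.
Qed.

Lemma material0 h x : smooth h -> x ord0 s = 0 -> material (primc s h) x = h x.
Proof. by move=> sh x0; rewrite materialE // !primc0 // mulr0 add0r addr0. Qed.

(** Since [f] is constant in the joint direction of [a] and [s], only its [m]-derivative survives.
    Once the common factor [vh + material Y] is known to vanish, every such [f] is carried unchanged
    along the flow. *)
Lemma material_displace f Y x : smooth f -> smooth Y ->
  (forall y, pd a f y + pd s f y = 0) ->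
  material (fun x => f (displace m Y x)) x =
  pd m f (displace m Y x) * (vh x + material Y x).
Proof.
move=> sf sY fas; rewrite /material !pd_displace //.
have := fas (displace m Y x).
move: (pd a f _) (pd s f _) (pd m f _) (pd a Y x) (pd s Y x) (pd m Y x) (vh x).
move=> A S M ya ys ym v /addr0_eq <-; ring.
Qed.

(* Along the [s]-axis the sum [vh + material Y] solves a homogeneous linear
   equation with zero initial value. *)
Lemma material_flow w Y x : smooth w -> smooth Y ->
  (forall y, pd a w y + pd s w y = 0) ->
  (forall y, y ord0 s = 0 -> w y = - vh y) ->
  (forall y, y ord0 s = 0 -> Y y = 0) ->
  (forall y, is_derive y (basis_vec s) Y (w (displace m Y y))) ->
  vh x + material Y x = 0.
Proof.
move=> sw sY was w0 Y0 dY; pose h y := w (displace m Y y).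
have sh : smooth h by exact: smooth_displace.
(* The flow equation and its initial value present [Y] as a primitive in [s], the form to which
   [is_derive_material] applies. *)
have YE : Y = primc s h.
  apply/funext => y; rewrite /primc -{1}(upd_same s y).
  apply: (@prim_unique _ (fun r => h (upd s y r)) (fun r => Y (upd s y r))).
  - by apply: continuous_line; exact: smooth_continuous.
  - by rewrite Y0 // updE eqxx.
  - by move=> r; apply/is_derive_line; exact: dY.
pose V y := vh y + material Y y.
have dV y : is_derive y (basis_vec s) V (pd m w (displace m Y y) * V y).
  rewrite -material_displace // -[X in is_derive _ _ _ X]add0r.
  apply: is_derive_add (vh_s y) _.
  by rewrite {1}YE; exact: is_derive_material.
have cb : continuous (fun y => pd m w (displace m Y y)).
  exact: smooth_continuous (smooth_displace m (smooth_pd m sw) sY).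
have L := @linear_ode _ (fun r => V (upd s x r)) (fun=> 0)
  (fun r => pd m w (displace m Y (upd s x r))) 0 (x ord0 s).
suff : V (upd s x (x ord0 s)) = 0 by rewrite upd_same.
apply: (etrans (L _ _ _ _) (mul0r _)).
- exact: cst_continuous.
- exact: (@continuous_line _ _ s (fun y => pd m w (displace m Y y)) x cb).
- by move=> r; rewrite mul0r add0r; apply/is_derive_line; exact: dV.
(* At s = 0 the material derivative of [Y] reduces to [h], which equals [w] there because [Y]
   vanishes, that is, to [- vh]. *)
- have x0 : (upd s x 0) ord0 s = 0 by rewrite updE eqxx.
  rewrite /V YE material0 // /h /displace Y0 // addr0 upd_same w0 //.
  by rewrite subrr.
Qed.

End MaterialDerivative.

Section Transport.
Context {R : realType}.
Implicit Types (f g v F : 'rV[R]_3 -> R) (x y : 'rV[R]_4) (z : 'rV[R]_3).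

Let o2 : 'I_4 := @Ordinal 4 1 isT.
Let o3 : 'I_4 := @Ordinal 4 2 isT.
Let o4 : 'I_4 := @Ordinal 4 3 isT.
Let inc (j : 'I_3) : 'I_4 := widen_ord (isT : (3 <= 4)%N) j.

(** Lifts of a function of three variables to the coordinates (x1, t, x3, s): [spacetime] ignores s,
    [retarded] evaluates at time t - s, [initial] at time 0. The last two are annihilated by d/dt +
    d/ds. Conversely [diag] returns to three variables by setting s = t. *)
Let spacetime f x := f (\row_j x ord0 (inc j)).
Let retarded f x := f (\row_j (x ord0 (inc j) - (j == i2)%:R * x ord0 o4)).
Let initial f x := f (\row_j (if j == i2 then 0 else x ord0 (inc j))).
Let diag (H : 'rV[R]_4 -> R) z :=
  H (\row_j z ord0 (match val j with 0%N => i1 | 2%N => i3 | _ => i2 end)).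

Let smooth_retarded f : smooth f -> smooth (retarded f).
Proof.
move=> sf; apply: (smooth_comp sf) => j; apply: smooth_sub; first exact: smooth_coord.
by apply: smooth_mul; [exact: smooth_cst|exact: smooth_coord].
Qed.

Let smooth_initial f : smooth f -> smooth (initial f).
Proof.
move=> sf; apply: (@smooth_comp _ _ _ _ (fun j x => if j == i2 then 0 else x ord0 (inc j)) sf) => j.
by case: (j == i2); [exact: smooth_cst|exact: smooth_coord].
Qed.

Let smooth_diag H : smooth H -> smooth (diag H).
Proof. by move=> sH; apply: (smooth_comp sH) => j; exact: smooth_coord. Qed.

Let pd_comp m n (f : 'rV[R]_m.+1 -> R) (phi : 'I_m.+1 -> 'rV[R]_n.+1 -> R)
    (l : 'I_n.+1) (x : 'rV[R]_n.+1) (d : 'I_m.+1 -> R) :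
  smooth f -> (forall j, is_derive x (basis_vec l) (phi j) (d j)) ->
  is_derive x (basis_vec l) (fun t : 'rV[R]_n.+1 => f (\row_j phi j t))
    (\sum_j pd j f (\row_j phi j x) * d j).
Proof.
move=> sf dphi; exact: (is_derive_comp (fun i u => smooth_is_derive i u sf)
  (fun i => smooth_continuous (smooth_pd i sf)) dphi).
Qed.

Let pd_retarded f l x : smooth f -> pd l (retarded f) x =
  \sum_j pd j f (\row_j (x ord0 (inc j) - (j == i2)%:R * x ord0 o4)) *
    ((l == inc j)%:R - (j == i2)%:R * (l == o4)%:R).
Proof.
move=> sf; apply: pdE; apply: (pd_comp sf) => j.
apply: is_derive_value (is_derive_sub (is_derive_basis_coord l (inc j) x)
  (is_derive_mul (is_derive_const x _ (j == i2)%:R) (is_derive_basis_coord l o4 x))).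
by rewrite mul0r add0r.
Qed.

Let retarded_sum f x : smooth f -> pd o2 (retarded f) x + pd o4 (retarded f) x = 0.
Proof.
move=> sf; rewrite !pd_retarded // -big_split /= big1 // => j _.
have -> : (o4 == inc j) = false by apply/eqP => /(congr1 val) /= E; have := ltn_ord j; rewrite -E.
have -> : (o2 == inc j) = (j == i2) by rewrite eq_sym.
by rewrite /= mulr0 mulr1 subr0 sub0r mulrN subrr.
Qed.

Let retarded_o3 f x : smooth f ->
  pd o3 (retarded f) x = pd i3 f (\row_j (x ord0 (inc j) - (j == i2)%:R * x ord0 o4)).
Proof.
move=> sf; rewrite pd_retarded // (bigD1 i3) //= big1 => [|j j3].
  by rewrite mulr0 subr0 mulr1 addr0.
have -> : (o3 == inc j) = (j == i3) by rewrite eq_sym.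
by rewrite (negbTE j3) mulr0 subr0 mulr0.
Qed.

Let initial_sum f x : smooth f -> pd o2 (initial f) x + pd o4 (initial f) x = 0.
Proof.
move=> sf.
have D l : l != inc i1 -> l != inc i3 -> pd l (initial f) x = 0.
  move=> l1 l3; apply: pdE; apply: is_derive_value (pd_comp (d := fun=> 0) sf _).
    by rewrite big1 // => j _; rewrite mulr0.
  move=> j; case: eqP => [_|j2]; first exact: is_derive_const.
  apply: is_derive_value (is_derive_basis_coord l (inc j) x).
  case: eqP => // lj; exfalso; move: j j2 lj => [[|[|[|//]]] jlt] j2 lj.
  - by move/eqP: l1; apply; rewrite lj; apply: val_inj.
  - by apply: j2; apply: val_inj.
  - by move/eqP: l3; apply; rewrite lj; apply: val_inj.
by rewrite !D // addr0.
Qed.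

Let spacetime_o4 v x : smooth v -> is_derive x (basis_vec o4) (spacetime v) 0.
Proof.
move=> sv; apply: is_derive_value (pd_comp (d := fun=> 0) sv _) => [|j].
  by rewrite big1 // => j _; rewrite mulr0.
apply: is_derive_value (is_derive_basis_coord o4 (inc j) x).
by case: eqP => // /(congr1 val) /= E; have := ltn_ord j; rewrite -E.
Qed.

Let pd_diag H l z : smooth H -> pd l (diag H) z =
  \sum_j pd j H (\row_j z ord0 (match val j with 0%N => i1 | 2%N => i3 | _ => i2 end)) *
    (l == match val j with 0%N => i1 | 2%N => i3 | _ => i2 end)%:R.
Proof.
by move=> sH; apply: pdE; apply: (pd_comp sH) => j; exact: is_derive_basis_coord.
Qed.

Let pd_diag2 H z : smooth H -> pd i2 (diag H) z = diag (pd o2 H) z + diag (pd o4 H) z.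
Proof.
move=> sH; rewrite pd_diag // (bigD1 o2) //= (bigD1 o4) //= big1 => [|j].
  by rewrite !mulr1 addr0.
by case: j => -[|[|[|[|//]]]] //= ? _; rewrite mulr0.
Qed.

Let pd_diag3 H z : smooth H -> pd i3 (diag H) z = diag (pd o3 H) z.
Proof.
move=> sH; rewrite pd_diag // (bigD1 o3) //= big1 => [|j].
  by rewrite !mulr1 addr0.
by case: j => -[|[|[|[|//]]]] //= ? _; rewrite mulr0.
Qed.

(* The characteristic through [(x1, t, x3)], followed backwards for a time
   [s], reaches [(x1, t - s, x3 + Y (x1, t, x3, s))]; evaluating at [s = t],
   i.e. composing with [diag], brings the data from the face [x2 = 0]. *)
Lemma transport v g F (B : R) : smooth v -> smooth g -> smooth F ->
  (forall z, `|v z| <= B) -> (forall z, `|pd i3 v z| <= B) ->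
  exists c : 'rV[R]_3 -> R, [/\ smooth c,
    forall z, pd i2 c z + v z * pd i3 c z = g z * c z,
    forall z, z ord0 i2 = 0 -> c z = F z
  & (forall z, 0 < F z) -> forall z, 0 < c z].
Proof.
move=> sv sg sF vB dvB.
(* The sign is that of a characteristic followed backwards: after elapsed time s its x3-velocity is
   -v taken at time t - s. *)
pose w x := - retarded v x.
have sw : smooth w by apply: smooth_opp; exact: smooth_retarded.
have pdw l x : pd l w x = - pd l (retarded v) x.
  by apply: pdE; apply: is_derive_opp; apply: smooth_is_derive; exact: smooth_retarded.
have wB x : `|w x| <= B by rewrite normrN; exact: vB.
have dwB x : `|pd o3 w x| <= B by rewrite pdw normrN retarded_o3.
have [Y [sY Y0 dY]] := @flow R 3 w o4 o3 B B sw wB dwB.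
pose vh := spacetime v.
have was x : pd o2 w x + pd o4 w x = 0 by rewrite !pdw -opprD retarded_sum // oppr0.
have ret0 f x : x ord0 o4 = 0 -> retarded f x = spacetime f x.
  by move=> x0; congr f; apply/rowP => j; rewrite !mxE x0 mulr0 subr0.
have vh_s x : is_derive x (basis_vec o4) vh 0 by exact: spacetime_o4.
have LY x : vh x + material vh o2 o4 o3 Y x = 0.
  apply: (@material_flow _ _ vh o2 o4 o3 vh_s isT isT w Y x) => // y y0.
  by rewrite /w ret0.
have L0 (f : 'rV[R]_4 -> R) x : smooth f -> (forall y, pd o2 f y + pd o4 f y = 0) ->
    material vh o2 o4 o3 (fun x => f (displace o3 Y x)) x = 0.
  by move=> sf fas; rewrite material_displace // LY mulr0.
(* [U] carries the initial datum along the characteristic, and [G] accumulates [g] over the elapsed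
   time; [U * exp G] is the method of characteristics before s = t is imposed. *)
pose U x := initial F (displace o3 Y x).
pose h x := retarded g (displace o3 Y x).
pose G := primc o4 h.
have sU : smooth U by apply: smooth_displace => //; exact: smooth_initial.
have sh : smooth h by apply: smooth_displace => //; exact: smooth_retarded.
have sG : smooth G by exact: smooth_primc.
have D0 x : x ord0 o4 = 0 -> displace o3 Y x = x.
  by move=> x0; rewrite /displace Y0 // addr0 upd_same.
(* The material derivative of [G] does not depend on s, since its s-derivative is the material
   derivative of [h], which vanishes by [L0]. Its value is therefore read off at s = 0. *)
have LG x : material vh o2 o4 o3 G x = spacetime g x.
  have dG (r : R) : is_derive r 1 (fun r => material vh o2 o4 o3 G (upd o4 x r)) 0.
    apply/is_derive_line; apply: is_derive_value
      (@is_derive_material _ _ vh o2 o4 o3 vh_s isT isT h _ sh).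
    by apply: L0; [exact: smooth_retarded|move=> y; exact: retarded_sum].
  have E := is_derive_eq_between (a := 0) (b := x ord0 o4) (fun r _ => dG r)
    (g := fun=> spacetime g x) (fun (r : R) _ => is_derive_const r 1 _).
  rewrite -[in LHS](upd_same o4 x); apply: E.
  rewrite material0 ?updE ?eqxx // /h D0 ?updE ?eqxx // ret0 ?updE ?eqxx //.
  congr g; apply/rowP => j; rewrite [LHS]mxE [RHS]mxE updE.
  by case: eqP => // /(congr1 val) /= E; have := ltn_ord j; rewrite E.
pose W x := U x * expR (G x).
have sW : smooth W by apply: smooth_mul => //; exact: smooth_exp.
have pdW l x : pd l W x = (pd l U x + U x * pd l G x) * expR (G x).
  apply: pdE; apply: is_derive_value (is_derive_mul (smooth_is_derive l x sU)
    (is_derive_exp (smooth_is_derive l x sG))).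
  by ring.
have LW x : material vh o2 o4 o3 W x = spacetime g x * W x.
  have := L0 _ x (smooth_initial sF) (fun y => initial_sum y sF).
  have := LG x; rewrite /material !pdW -/U /W.
  move: (pd o2 U x) (pd o4 U x) (pd o3 U x) (pd o2 G x) (pd o4 G x) (pd o3 G x).
  move: (U x) (expR (G x)) (vh x) (spacetime g x) => u e q k u2 u4 u3 g2 g4 g3 <- E.
  transitivity ((u2 + u4 + q * u3) * e + u * (g2 + g4 + q * g3) * e); first by ring.
  by rewrite E; ring.
have st f z : diag (spacetime f) z = f z.
  rewrite /diag /spacetime; congr f; apply/rowP => j; rewrite !mxE.
  by congr (z _ _); apply: val_inj; case: j => -[|[|[|//]]].
exists (diag W); split.
- exact: smooth_diag.
(* The x2-derivative of a function composed with [diag] is the sum of its t- and s-derivatives, so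
   the identity [LW] is exactly the transport equation. *)
- move=> z; rewrite pd_diag2 // pd_diag3 //.
  by rewrite -[in v z](st v) -[in g z](st g); exact: LW.
- move=> z z2; rewrite /diag /W /U /G D0 ?primc0 ?expR0 ?mulr1 ?mxE //.
  rewrite /initial; congr F; apply/rowP => j; rewrite !mxE.
  by case: j => -[|[|[|//]]] //= ?; rewrite -?z2; congr (z _ _); exact: val_inj.
- by move=> F0 z; rewrite mulr_gt0 ?expR_gt0 //; exact: F0.
Qed.

End Transport.

(** * Functions on the cube *)

Section CubePartial.
Context {R : realType} {n : nat} (delta : R).
Hypothesis delta_gt0 : 0 < delta.
Implicit Types (f g u v w : 'rV[R]_n.+1 -> R) (x y : 'rV[R]_n.+1) (l j : 'I_n.+1).

Lemma cube_upd l x r : cube delta x -> 0 <= r <= delta -> cube delta (upd l x r).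
Proof. by move=> xC r01 j; rewrite updE; case: eqP => // _; exact: xC. Qed.

(** From any coordinate in [0, delta] one can move by up to delta / 2 in at least one direction
    without leaving the cube. The limit in [partial] is thus over a proper filter and is unique,
    also on faces, edges and corners. *)
Lemma within_cube_proper l x : cube delta x ->
  ProperFilter (within [set h : R | cube delta (x + h *: basis_vec l)] (0 : R)^').
Proof.
move=> xC; apply: Build_ProperFilter_ex => P [e /= e0 H].
have /andP[x0 x1] := xC l.
pose k := Num.min (e / 2) (delta / 2).
have k0 : 0 < k by rewrite lt_min !divr_gt0.
have ke : k < e by rewrite gt_min; apply/orP; left; lra.
have kd : k <= delta / 2 by rewrite ge_min lexx orbT.
pose h := if x ord0 l <= delta / 2 then k else - k.
have hk : `|h| = k by rewrite /h; case: ifP => _; rewrite ?normrN gtr0_norm.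
have h0 : h != 0 by rewrite -normr_gt0 hk.
have hx : 0 <= h + x ord0 l <= delta.
  by rewrite /h; case: (leP (x ord0 l) (delta / 2)) => ?; apply/andP; split; lra.
exists h; apply: H => //=; first by rewrite sub0r normrN hk.
by rewrite addrC upd_line; exact: cube_upd.
Qed.

(** This bridge turns the one-sided derivatives in the constraints into ordinary derivatives of
    whole-space representatives, whichever extension is chosen. *)
Lemma partialE l f g x : smooth g -> eq_on_cube delta f g -> cube delta x ->
  partial delta l f x = pd l g x.
Proof.
move=> sg fg xC; have PF := within_cube_proper l xC.
apply: cvg_lim => //.
have /is_deriveP H := smooth_is_derive l x sg.
have H' : h^-1 * (g (h *: basis_vec l + x) - g x)
    @[h --> within [set h : R | cube delta (x + h *: basis_vec l)] (0 : R)^'] -->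
    pd l g x.
  by apply: cvg_within_filter; exact: H.
apply: cvg_trans H'; apply: near_eq_cvg; apply: filterS (withinT _ _) => h /= hC.
by rewrite !fg // [x + _]addrC.
Qed.

(** Both derivatives equal the one-sided [partial], which sees the cube only; this covers boundary
    points, where the functions need not agree on a neighbourhood. *)
Lemma pd_eq_on_cube l f g x : smooth f -> smooth g -> eq_on_cube delta f g ->
  cube delta x -> pd l f x = pd l g x.
Proof.
move=> sf sg fg xC; rewrite -(@partialE l f f x) //.
exact: partialE.
Qed.

Lemma pd_at_max_le0 l f c : smooth f -> cube delta c ->
  (forall x, cube delta x -> f x <= f c) -> c ord0 l < delta -> pd l f c <= 0.
Proof.
move=> sf cC cmax cl; rewrite leNgt; apply/negP => d0.
have /is_deriveP /cvgr_gt /(_ 0 d0) [e /= e0 H] := smooth_is_derive l c sf.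
pose h := Num.min (e / 2) (delta - c ord0 l).
have h0 : 0 < h by rewrite lt_min divr_gt0 //= subr_gt0.
have he : h < e by rewrite gt_min; apply/orP; left; lra.
have hd : h <= delta - c ord0 l by rewrite ge_min lexx orbT.
have := H h; rewrite /= sub0r normrN gtr0_norm // gt_eqF // => /(_ he isT).
rewrite pmulr_rgt0 ?invr_gt0 // subr_gt0 ltNge cmax //.
rewrite upd_line; apply: cube_upd => //.
by have /andP[? ?] := cC l; apply/andP; split; lra.
Qed.

Lemma pd_at_max_ge0 l f c : smooth f -> cube delta c ->
  (forall x, cube delta x -> f x <= f c) -> 0 < c ord0 l -> 0 <= pd l f c.
Proof.
move=> sf cC cmax cl; rewrite leNgt; apply/negP => d0.
have /is_deriveP /cvgr_lt /(_ 0 d0) [e /= e0 H] := smooth_is_derive l c sf.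
pose h := Num.min (e / 2) (c ord0 l).
have h0 : 0 < h by rewrite lt_min divr_gt0.
have he : h < e by rewrite gt_min; apply/orP; left; lra.
have hd : h <= c ord0 l by rewrite ge_min lexx orbT.
have := H (- h); rewrite /= sub0r opprK gtr0_norm // oppr_eq0 gt_eqF // => /(_ he isT).
rewrite invrN mulNr oppr_lt0 pmulr_rgt0 ?invr_gt0 // subr_gt0 ltNge cmax //.
rewrite upd_line; apply: cube_upd => //.
by have /andP[? ?] := cC l; apply/andP; split; lra.
Qed.

(* After multiplication by [expR (- (M + 1) * x_l0)] the zeroth order
   coefficient is negative, so a positive maximum could only be attained on
   the inflow part of the boundary. *)
Lemma transport_max_principle w (b : 'I_n.+1 -> 'rV[R]_n.+1 -> R) (mu : 'rV[R]_n.+1 -> R)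
    (l0 : 'I_n.+1) (M : R) : smooth w ->
  (forall x, cube delta x -> b l0 x = 1) ->
  (forall x, cube delta x -> mu x <= M) ->
  (forall x, cube delta x -> \sum_l b l x * pd l w x = mu x * w x) ->
  (forall x l, cube delta x ->
     (x ord0 l = 0 /\ 0 < b l x) \/ (x ord0 l = delta /\ b l x < 0) -> w x = 0) ->
  forall x, cube delta x -> w x <= 0.
Proof.
move=> sw b1 muM weq inflow x xC.
pose E (y : 'rV[R]_n.+1) := expR (- (M + 1) * y ord0 l0).
have E0 y : 0 < E y := expR_gt0 _.
pose Y y := w y * E y.
have sE : smooth E.
  by apply: smooth_exp; apply: smooth_mul; [exact: smooth_cst|exact: smooth_coord].
have sY : smooth Y by exact: smooth_mul.
have C0 : @cube R n delta !=set0 by exists 0; exact: cube0.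
have [c /set_mem cC cmax] := EVT_max_rV C0 (@cube_compact R n delta)
  (continuous_subspaceT (smooth_continuous sY)).
have {}cmax y : cube delta y -> Y y <= Y c by move=> yC; apply: cmax; exact/mem_set.
case: (leP (Y c) 0) => Yc.
  by have := le_trans (cmax x xC) Yc; rewrite pmulr_lle0.
have wc : 0 < w c by move: Yc; rewrite pmulr_lgt0.
(* Each term is nonnegative at the maximum: if [b l c] is negative there is room to move forward, if
   positive to move backward, for otherwise [c] would be an inflow point, where [w] vanishes
   although [w c] is positive. The equation makes the same sum negative. *)
have ge0 : 0 <= \sum_l b l c * pd l Y c.
  apply: sumr_ge0 => l _; have /andP[c0 c1] := cC l.
  have ninflow : ~ ((c ord0 l = 0 /\ 0 < b l c) \/ (c ord0 l = delta /\ b l c < 0)).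
    by move=> /(inflow c l cC) H; rewrite H ltxx in wc.
  case: (ltgtP (b l c) 0) => bl; last by rewrite bl mul0r.
  - rewrite nmulr_rge0 //; apply: pd_at_max_le0 => //.
    by rewrite lt_neqAle c1 andbT; apply/eqP => E'; apply: ninflow; right.
  - rewrite pmulr_rge0 //; apply: pd_at_max_ge0 => //.
    by rewrite lt_neqAle c0 andbT; apply/eqP => E'; apply: ninflow; left.
have pdY l : pd l Y c = (pd l w c - (l == l0)%:R * ((M + 1) * w c)) * E c.
  apply: pdE; apply: is_derive_value (is_derive_mul (smooth_is_derive l c sw)
    (is_derive_exp (is_derive_mul (is_derive_const c _ (- (M + 1)))
      (is_derive_basis_coord l l0 c)))).
  by rewrite -/(E c); ring.
have eqY : \sum_l b l c * pd l Y c = (mu c - (M + 1)) * w c * E c.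
  under eq_bigr do rewrite pdY mulrA mulrBr.
  rewrite -mulr_suml sumrB weq // (bigD1 l0) //= big1 => [|l /negbTE ->]; last first.
    by rewrite mul0r mulr0.
  by rewrite eqxx b1 // !mul1r addr0; ring.
move: ge0; rewrite eqY pmulr_lge0 // pmulr_lge0 //.
have := muM c cC; lra.
Qed.

(** The source [q] cancels in a difference of solutions, and the maximum principle applies to the
    difference in both orders. Compactness of the cube bounds the coefficient [mu] from above. *)
Lemma transport_unique u u' (b : 'I_n.+1 -> 'rV[R]_n.+1 -> R)
    (mu q : 'rV[R]_n.+1 -> R) (l0 : 'I_n.+1) :
  smooth u -> smooth u' -> continuous mu ->
  (forall x, cube delta x -> b l0 x = 1) ->
  (forall x, cube delta x -> \sum_l b l x * pd l u x = mu x * u x + q x) ->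
  (forall x, cube delta x -> \sum_l b l x * pd l u' x = mu x * u' x + q x) ->
  (forall x l, cube delta x ->
     (x ord0 l = 0 /\ 0 < b l x) \/ (x ord0 l = delta /\ b l x < 0) -> u x = u' x) ->
  eq_on_cube delta u u'.
Proof.
move=> su su' cmu b1 equ equ' inflow.
have [M HM] := bounded_on_box cmu (ltW delta_gt0).
have muM x : cube delta x -> mu x <= M.
  by move=> xC; apply: le_trans (ler_norm _) (HM x xC).
have main v v' : smooth v -> smooth v' ->
    (forall x, cube delta x -> \sum_l b l x * pd l v x = mu x * v x + q x) ->
    (forall x, cube delta x -> \sum_l b l x * pd l v' x = mu x * v' x + q x) ->
    (forall x l, cube delta x ->
     (x ord0 l = 0 /\ 0 < b l x) \/ (x ord0 l = delta /\ b l x < 0) -> v x = v' x) ->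
    forall x, cube delta x -> v x <= v' x.
  move=> sv sv' eqv eqv' inf x xC; rewrite -subr_le0.
  apply: (@transport_max_principle (fun x => v x - v' x) b mu l0 M) => //.
  - exact: smooth_sub.
  - move=> y yC.
    have pdB l : pd l (fun x => v x - v' x) y = pd l v y - pd l v' y.
      by apply: pdE; apply: is_derive_sub; apply: smooth_is_derive.
    under eq_bigr do rewrite pdB mulrBr.
    by rewrite sumrB eqv // eqv' //; ring.
  - by move=> y l yC /(inf y l yC) ->; rewrite subrr.
move=> x xC; apply/eqP; rewrite eq_le !main // => y l yC H.
by apply/esym; apply: inflow H.
Qed.

Lemma transport_linear_exists l (m q F : 'rV[R]_n.+1 -> R) :
  smooth m -> smooth q -> smooth F ->
  exists y : 'rV[R]_n.+1 -> R, [/\ smooth y, forall x, pd l y x = m x * y x + q x,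
    forall x, x ord0 l = 0 -> y x = F x
  & (forall x, q x = 0) -> (forall x, 0 < F x) -> forall x, 0 < y x].
Proof.
move=> sm sq sF; pose A := primc l m.
have sA : smooth A by exact: smooth_primc.
(* The datum is frozen at its value on x_l = 0, so it behaves as a constant of integration in the
   formula exp(A) (F0 + primitive of exp(-A) q). *)
pose F0 (x : 'rV[R]_n.+1) := F (\row_j (if j == l then 0 else x ord0 j)).
have sF0 : smooth F0.
  apply: (@smooth_comp _ _ _ F (fun j x => if j == l then 0 else x ord0 j) sF) => j.
  by case: (j == l); [exact: smooth_cst|exact: smooth_coord].
pose h x := expR (- A x) * q x.
have sh : smooth h.
  by apply: smooth_mul => //; apply: smooth_exp; exact: smooth_opp.
exists (fun x => expR (A x) * (F0 x + primc l h x)); split.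
- apply: smooth_mul; first exact: smooth_exp.
  by apply: smooth_add => //; exact: smooth_primc.
- move=> x; apply: pdE.
  have dF0 : is_derive x (basis_vec l) F0 0.
    apply/is_derive_upd; have -> : (fun r => F0 (upd l x r)) = (fun=> F0 x).
      apply/funext => r; congr F; apply/rowP => j; rewrite [LHS]mxE [RHS]mxE updE.
      by case: eqP.
    exact: is_derive_const.
  apply: is_derive_value (is_derive_mul
    (is_derive_exp (is_derive_primc l x (smooth_continuous sm)))
    (is_derive_add dF0 (is_derive_primc l x (smooth_continuous sh)))).
  have EE : expR (A x) * h x = q x by rewrite /h mulrA -expRD subrr expR0 mul1r.
  by rewrite add0r EE -/A; ring.
- move=> x x0; rewrite /A !primc0 // expR0 mul1r addr0; congr F.
  by apply/rowP => j; rewrite mxE; case: eqP => [->|//]; rewrite x0.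
- move=> q0 F1 x; rewrite mulr_gt0 ?expR_gt0 //.
  have -> : h = fun=> 0 by apply/funext => y; rewrite /h q0 mulr0.
  have -> : primc l (fun=> 0) x = 0.
    apply/esym; apply: (@prim_unique _ (fun=> 0) (fun=> 0)) => //.
    exact: cst_continuous.
  by rewrite addr0; exact: F1.
Qed.

End CubePartial.

(** * The constraint equations *)

Section Constraints.
Context {R : realType} (delta : R).
Hypothesis delta_gt0 : 0 < delta.
Implicit Types (f g : 'rV[R]_3 -> R) (x : 'rV[R]_3).
Implicit Types (p P : 'I_3 -> 'rV[R]_3 -> R) (c : 'I_3 -> 'I_3 -> 'rV[R]_3 -> R).

Definition logd l f x : R := pd l f x / f x.

(** The constraints for whole-space representatives, with kappa_i^i = -p_i inserted. The term in
    c_ii carries the factor p_i - p_i and disappears, so the third constraint involves c_11 and c_22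
    only; the second adds c_33 and kappa_2^3, the first the other two components. *)
Definition eq3 P (C1 C2 : 'rV[R]_3 -> R) x : R :=
  logd i3 C1 x * (P i1 x - P i3 x) + logd i3 C2 x * (P i2 x - P i3 x)
  - 2 * pd i3 (P i3) x.

Definition eq2 P (C1 C2 C3 k23 : 'rV[R]_3 -> R) x : R :=
  logd i2 C1 x * (P i1 x - P i2 x) + logd i2 C3 x * (P i3 x - P i2 x)
  - 2 * pd i2 (P i2) x + 2 * pd i3 k23 x
  + (logd i3 C1 x + logd i3 C2 x + logd i3 C3 x) * k23 x.

Definition eq1 P (C1 C2 C3 k12 k13 : 'rV[R]_3 -> R) x : R :=
  logd i1 C2 x * (P i2 x - P i1 x) + logd i1 C3 x * (P i3 x - P i1 x)
  - 2 * pd i1 (P i1) x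
  + 2 * pd i2 k12 x + (logd i2 C1 x + logd i2 C2 x + logd i2 C3 x) * k12 x
  + 2 * pd i3 k13 x + (logd i3 C1 x + logd i3 C2 x + logd i3 C3 x) * k13 x.

Lemma sum_ord3 (F : 'I_3 -> R) : \sum_l F l = F i1 + F i2 + F i3.
Proof.
rewrite !big_ord_recr big_ord0 /= add0r.
by congr (F _ + F _ + F _); apply: val_inj.
Qed.

Lemma ord3P (Q : 'I_3 -> Prop) : Q i1 -> Q i2 -> Q i3 -> forall i, Q i.
Proof.
move=> q1 q2 q3 [[|[|[|//]]] ilt].
- by rewrite (_ : Ordinal ilt = i1) //; apply: val_inj.
- by rewrite (_ : Ordinal ilt = i2) //; apply: val_inj.
- by rewrite (_ : Ordinal ilt = i3) //; apply: val_inj.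
Qed.

Section Represented.
Variables (p P : 'I_3 -> 'rV[R]_3 -> R) (c : 'I_3 -> 'I_3 -> 'rV[R]_3 -> R).
Variables (C1 C2 C3 k12 k13 k23 : 'rV[R]_3 -> R).
Hypothesis sP : forall i, smooth (P i).
Hypothesis pP : forall i, eq_on_cube delta (p i) (P i).
Hypotheses (sC1 : smooth C1) (sC2 : smooth C2) (sC3 : smooth C3).
Hypotheses (sk12 : smooth k12) (sk13 : smooth k13) (sk23 : smooth k23).
Hypotheses (C1_gt0 : forall x, cube delta x -> 0 < C1 x)
  (C2_gt0 : forall x, cube delta x -> 0 < C2 x)
  (C3_gt0 : forall x, cube delta x -> 0 < C3 x).
Hypotheses (cC1 : eq_on_cube delta (c i1 i1) C1)
  (cC2 : eq_on_cube delta (c i2 i2) C2) (cC3 : eq_on_cube delta (c i3 i3) C3).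
Hypotheses (ck12 : eq_on_cube delta (kappa p c i1 i2) k12)
  (ck13 : eq_on_cube delta (kappa p c i1 i3) k13)
  (ck23 : eq_on_cube delta (kappa p c i2 i3) k23).

Let partial_diag_prod l x : cube delta x ->
  partial delta l (diag_prod c) x / diag_prod c x =
  logd l C1 x + logd l C2 x + logd l C3 x.
Proof.
move=> xC; pose D x := C1 x * C2 x * C3 x.
have cD : eq_on_cube delta (diag_prod c) D.
  by move=> y yC; rewrite /diag_prod cC1 // cC2 // cC3.
have sD : smooth D by do 2?apply: smooth_mul.
rewrite (partialE delta_gt0 l sD cD xC) cD //.
have -> : pd l D x = pd l C1 x * C2 x * C3 x + C1 x * pd l C2 x * C3 x +
    C1 x * C2 x * pd l C3 x.
  apply: pdE; apply: is_derive_value (is_derive_mul (is_derive_mul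
    (smooth_is_derive l x sC1) (smooth_is_derive l x sC2)) (smooth_is_derive l x sC3)).
  by ring.
rewrite /logd /D; move: (C1_gt0 xC) (C2_gt0 xC) (C3_gt0 xC).
move: (C1 x) (C2 x) (C3 x) (pd l C1 x) (pd l C2 x) (pd l C3 x) => a b d a' b' d' a0 b0 d0.
by field; rewrite !gt_eqF.
Qed.

Let partial_c l j x : cube delta x -> partial delta l (c j j) x / c j j x =
  logd l (match val j with 0%N => C1 | 1%N => C2 | _ => C3 end) x.
Proof.
move=> xC; elim/ord3P: j; rewrite /logd /=.
- by rewrite (partialE delta_gt0 l sC1 cC1 xC) cC1.
- by rewrite (partialE delta_gt0 l sC2 cC2 xC) cC2.
- by rewrite (partialE delta_gt0 l sC3 cC3 xC) cC3.
Qed.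

Let partial_kappa_diag i x : cube delta x ->
  partial delta i (kappa p c i i) x = - pd i (P i) x.
Proof.
move=> xC; have sN : smooth (fun x => - P i x) by exact: smooth_opp.
have kN : eq_on_cube delta (kappa p c i i) (fun x => - P i x).
  move=> y yC; rewrite -pP //.
  by move: i {sN}; apply: ord3P.
rewrite (partialE delta_gt0 i sN kN xC).
by apply: pdE; apply: is_derive_opp; exact: smooth_is_derive.
Qed.

Let partial_zero l x : cube delta x -> partial delta l (fun _ : 'rV[R]_3 => 0) x = 0.
Proof.
move=> xC; rewrite (partialE delta_gt0 l (smooth_cst 0) _ xC) //.
by apply: pdE; exact: is_derive_const.
Qed.

Lemma constraint3 x : cube delta x -> constraint delta p c i3 x = eq3 P C1 C2 x.
Proof.
move=> xC; have pc j := partial_c i3 j xC.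
rewrite /constraint sum_ord3 (pc i1) (pc i2) (pc i3) /=.
rewrite (partial_kappa_diag i3 xC) !(pP _ xC).
have -> : partial delta i1 (kappa p c i3 i1) x = 0 by exact: partial_zero.
have -> : partial delta i2 (kappa p c i3 i2) x = 0 by exact: partial_zero.
rewrite /eq3; move: (logd i3 C1 x) (logd i3 C2 x) (logd i3 C3 x) (pd i3 (P i3) x).
move: (P i1 x) (P i2 x) (P i3 x) (partial delta i1 _ x) (partial delta i2 _ x)
  (partial delta i3 _ x) (diag_prod c x) (kappa p c i3 i1 x) (kappa p c i3 i2 x)
  (kappa p c i3 i3 x) => p1 p2 p3 d1 d2 d3 dp ka kb kc L1 L2 L3 dP; ring.
Qed.

Lemma constraint2 x : cube delta x -> constraint delta p c i2 x = eq2 P C1 C2 C3 k23 x.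
Proof.
move=> xC; have pc j := partial_c i2 j xC; have pD l := partial_diag_prod l xC.
rewrite /constraint sum_ord3 (pc i1) (pc i2) (pc i3) (pD i1) (pD i2) (pD i3) /=.
rewrite (partial_kappa_diag i2 xC) !(pP _ xC) (ck23 xC).
rewrite (partialE delta_gt0 i3 sk23 ck23 xC).
have -> : partial delta i1 (kappa p c i2 i1) x = 0 by exact: partial_zero.
rewrite /eq2; move: (logd i2 C1 x) (logd i2 C2 x) (logd i2 C3 x) (pd i2 (P i2) x).
move: (logd i3 C1 x) (logd i3 C2 x) (logd i3 C3 x) (pd i3 k23 x) (k23 x).
move: (logd i1 C1 x) (logd i1 C2 x) (logd i1 C3 x).
move: (P i1 x) (P i2 x) (P i3 x) (kappa p c i2 i1 x) (kappa p c i2 i2 x).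
by move=> p1 p2 p3 ka kb L1 L2 L3 M1 M2 M3 dk k N1 N2 N3 dP; ring.
Qed.

Lemma constraint1 x : cube delta x ->
  constraint delta p c i1 x = eq1 P C1 C2 C3 k12 k13 x.
Proof.
move=> xC; have pc j := partial_c i1 j xC; have pD l := partial_diag_prod l xC.
rewrite /constraint sum_ord3 (pc i1) (pc i2) (pc i3) (pD i1) (pD i2) (pD i3) /=.
rewrite (partial_kappa_diag i1 xC) !(pP _ xC) (ck12 xC) (ck13 xC).
rewrite (partialE delta_gt0 i2 sk12 ck12 xC) (partialE delta_gt0 i3 sk13 ck13 xC).
rewrite /eq1; move: (logd i2 C1 x) (logd i2 C2 x) (logd i2 C3 x) (pd i1 (P i1) x).
move: (logd i3 C1 x) (logd i3 C2 x) (logd i3 C3 x) (pd i3 k13 x) (k13 x).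
move: (logd i1 C1 x) (logd i1 C2 x) (logd i1 C3 x) (pd i2 k12 x) (k12 x).
move: (P i1 x) (P i2 x) (P i3 x) (kappa p c i1 i1 x).
by move=> p1 p2 p3 ka L1 L2 L3 dk k M1 M2 M3 dk' k' N1 N2 N3 dP; ring.
Qed.

End Represented.

(** The differences of the representatives [P] are known to be positive on the cube only. Replacing
    them by positive functions on the whole space allows division by them everywhere. *)
Lemma kasner_gaps p P : kasner delta p ->
  (forall i, smooth (P i)) -> (forall i, eq_on_cube delta (p i) (P i)) ->
  exists d12 d13 d23 : 'rV[R]_3 -> R,
  [/\ [/\ smooth d12, smooth d13 & smooth d23],
      [/\ forall x, 0 < d12 x, forall x, 0 < d13 x & forall x, 0 < d23 x]
    & forall x, cube delta x -> [/\ P i2 x - P i1 x = d12 x,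
        P i3 x - P i1 x = d13 x & P i3 x - P i2 x = d23 x]].
Proof.
move=> kp sP pP.
have ext i j : (forall x, cube delta x -> p i x < p j x) ->
    exists d, [/\ smooth d, forall x, 0 < d x
      & eq_on_cube delta (fun x => P j x - P i x) d].
  move=> H; apply: positive_extension => //.
    by exists (fun x => P j x - P i x) => //; exact: smooth_sub.
  by move=> x xC; rewrite -!pP // subr_gt0; exact: H.
have [d12 [s12 d12p E12]] : exists d, [/\ smooth d, forall x, 0 < d x
    & eq_on_cube delta (fun x => P i2 x - P i1 x) d].
  by apply: ext => x /kp[].
have [d23 [s23 d23p E23]] : exists d, [/\ smooth d, forall x, 0 < d x
    & eq_on_cube delta (fun x => P i3 x - P i2 x) d].
  by apply: ext => x /kp[].
have [d13 [s13 d13p E13]] : exists d, [/\ smooth d, forall x, 0 < d x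
    & eq_on_cube delta (fun x => P i3 x - P i1 x) d].
  by apply: ext => x /kp[h1 h2 _ _]; exact: lt_trans h1 h2.
exists d12, d13, d23; split=> // x xC; split; [exact: E12|exact: E13|exact: E23].
Qed.

(** The formulas for kappa are triangular in the off-diagonal entries: kappa_1^2 gives c_12,
    kappa_2^3 gives c_23, and kappa_1^3 then gives c_13. The minus signs come from p_1 - p_2 = - d12
    and its analogues. *)
Lemma metric_of_components p P (C1 C2 C3 k12 k13 k23 : 'rV[R]_3 -> R) :
  kasner delta p ->
  (forall i, smooth (P i)) -> (forall i, eq_on_cube delta (p i) (P i)) ->
  smooth C1 -> smooth C2 -> smooth C3 -> smooth k12 -> smooth k13 -> smooth k23 ->
  (forall x, 0 < C1 x) -> (forall x, 0 < C2 x) -> (forall x, 0 < C3 x) ->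
  exists c, [/\ forall i j, smooth (c i j), forall i j, c i j = c j i,
    [/\ c i1 i1 = C1, c i2 i2 = C2 & c i3 i3 = C3]
  & [/\ eq_on_cube delta (kappa p c i1 i2) k12,
        eq_on_cube delta (kappa p c i1 i3) k13
      & eq_on_cube delta (kappa p c i2 i3) k23]].
Proof.
move=> kp sP pP sC1 sC2 sC3 sk12 sk13 sk23 C1p C2p C3p.
have [d12 [d13 [d23 [[s12 s13 s23] [d12p d13p d23p] E]]]] := kasner_gaps kp sP pP.
have nz f x : (forall x, 0 < f x) -> f x != 0 by move=> f0; rewrite gt_eqF.
have sV f : smooth f -> (forall x, 0 < f x) -> smooth (fun x => (f x)^-1).
  by move=> sf f0; apply: smooth_inv => // x; exact: nz.
pose c12 x := - (k12 x * C2 x * (d12 x)^-1).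
pose c23 x := - (k23 x * C3 x * (d23 x)^-1).
pose c13 x := - ((k13 x - d12 x * (c12 x * c23 x * ((C2 x)^-1 * (C3 x)^-1))) * C3 x * (d13 x)^-1).
have s12' : smooth c12.
  by apply: smooth_opp; do !apply: smooth_mul => //; exact: sV.
have s23' : smooth c23.
  by apply: smooth_opp; do !apply: smooth_mul => //; exact: sV.
have s13' : smooth c13.
  apply: smooth_opp; apply: smooth_mul; last exact: sV.
  apply: smooth_mul => //; apply: smooth_sub => //; apply: smooth_mul => //.
  by do !apply: smooth_mul => //; exact: sV.
pose c (i j : 'I_3) := match val i, val j with
  | 0%N, 0%N => C1 | 1%N, 1%N => C2 | 2%N, 2%N => C3
  | 0%N, 1%N | 1%N, 0%N => c12
  | 1%N, 2%N | 2%N, 1%N => c23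
  | _, _ => c13 end.
exists c; split.
- by apply: ord3P; apply: ord3P.
- by apply: ord3P; apply: ord3P.
- by [].
- have dE x : cube delta x -> [/\ p i1 x - p i2 x = - d12 x,
      p i2 x - p i3 x = - d23 x, p i1 x - p i3 x = - d13 x & p i2 x - p i1 x = d12 x].
    by move=> xC; have [<- <- <-] := E x xC; rewrite !pP // !opprB.
  split=> x /dE[e1 e2 e3 e4]; rewrite /kappa /= ?e1 ?e2 ?e3 ?e4 /c /=;
    rewrite /c13 /c12 /c23; move: (d12p x) (d23p x) (d13p x) (C2p x) (C3p x);
    move: (d12 x) (d23 x) (d13 x) (C2 x) (C3 x) (k12 x) (k13 x) (k23 x);
    move=> a b d u v k l m a0 b0 d0 u0 v0; field; by rewrite !gt_eqF.
Qed.

(** The same triangular system is cancelled in the same order; the strict gaps between the p_i and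
    the positive diagonal of [c] provide the nonzero factors. *)
Lemma metric_unique p c c' : kasner delta p ->
  symmetric_on_cube delta c -> symmetric_on_cube delta c' ->
  (forall i x, cube delta x -> 0 < c i i x) ->
  (forall u, eq_on_cube delta (component_val p c' u) (component_val p c u)) ->
  forall i j, eq_on_cube delta (c' i j) (c i j).
Proof.
move=> kp sc sc' c0 H i j x xC; have [p12 p23 _ _] := kp x xC.
have p13 := lt_trans p12 p23.
have h1 := H C11 x xC; have h2 := H C22 x xC; have h3 := H C33 x xC.
have c2 := c0 i2 x xC; have c3 := c0 i3 x xC.
have k12 := H K12 x xC; have k23 := H K23 x xC; have k13 := H K13 x xC.
rewrite /= in h1 h2 h3; rewrite /= /kappa /= h2 in k12.
rewrite /= /kappa /= h3 in k23; rewrite /= /kappa /= h2 h3 in k13.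
have e12 : c' i1 i2 x = c i1 i2 x.
  have /mulfI/(_ _ _ k12) : p i1 x - p i2 x != 0 by rewrite subr_eq0 lt_eqF.
  by apply: mulIf; rewrite invr_eq0 gt_eqF.
have e23 : c' i2 i3 x = c i2 i3 x.
  have /mulfI/(_ _ _ k23) : p i2 x - p i3 x != 0 by rewrite subr_eq0 lt_eqF.
  by apply: mulIf; rewrite invr_eq0 gt_eqF.
have e13 : c' i1 i3 x = c i1 i3 x.
  move: k13; rewrite e12 e23 => /addrI k13.
  have /mulfI/(_ _ _ k13) : p i1 x - p i3 x != 0 by rewrite subr_eq0 lt_eqF.
  by apply: mulIf; rewrite invr_eq0 gt_eqF.
move: i j; apply: ord3P; apply: ord3P => //.
- by rewrite sc' // sc.
- by rewrite sc' // sc.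
- by rewrite sc' // sc.
Qed.

End Constraints.

(** * Solving the three constraints *)

Section Existence.
Context {R : realType} (delta : R).
Hypothesis delta_gt0 : 0 < delta.
Variables (P : 'I_3 -> 'rV[R]_3 -> R) (d12 d13 d23 : 'rV[R]_3 -> R).
Hypothesis sP : forall i, smooth (P i).
Hypotheses (s12 : smooth d12) (s13 : smooth d13) (s23 : smooth d23).
Hypotheses (d13_gt0 : forall x, 0 < d13 x)
  (d23_gt0 : forall x, 0 < d23 x).
Hypothesis gaps : forall x, cube delta x -> [/\ P i2 x - P i1 x = d12 x,
        P i3 x - P i1 x = d13 x & P i3 x - P i2 x = d23 x].
Implicit Types (f g F A N : 'rV[R]_3 -> R) (x : 'rV[R]_3).

Lemma initial_extension (l : 'I_3) (f : 'rV[R]_2 -> R) : smooth_on_cube delta f ->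
  exists2 F, smooth F & forall x, cube delta x -> F x = f (col' l x).
Proof.
move=> [g sg fg]; exists (fun x => g (\row_j x ord0 (lift l j))).
  by apply: (smooth_comp sg) => j; exact: smooth_coord.
move=> x xC; rewrite (_ : \row_j _ = col' l x); last by apply/rowP => j; rewrite !mxE.
by rewrite fg // => j; rewrite mxE; exact: xC.
Qed.

Lemma positive_initial_extension (l : 'I_3) (f : 'rV[R]_2 -> R) :
  smooth_on_cube delta f -> (forall y, cube delta y -> 0 < f y) ->
  exists F, [/\ smooth F, forall x, 0 < F x
    & forall x, cube delta x -> F x = f (col' l x)].
Proof.
move=> sf f0; have [F0 sF0 F0E] := initial_extension l sf.
have sF0' : smooth_on_cube delta F0 by exists F0.
have p0 x : cube delta x -> 0 < F0 x.
  by move=> xC; rewrite F0E //; apply: f0 => j; rewrite mxE; exact: xC.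
have [F [sF Fp FE]] := positive_extension delta_gt0 sF0' p0.
by exists F; split=> // x xC; rewrite -FE // F0E.
Qed.

Lemma smooth_logd l f : smooth f -> (forall x, 0 < f x) -> smooth (logd l f).
Proof.
move=> sf f0; apply: smooth_mul; first exact: smooth_pd.
by apply: smooth_inv => // x; rewrite gt_eqF.
Qed.

(** On the cube this is the third constraint with its sign reversed, so that the coefficients are
    the positive gaps. It prescribes the logarithmic derivative of [N] along x_3, and the resulting
    homogeneous linear equation preserves positivity. *)
Let solve_diag A F dA dN : smooth A -> (forall x, 0 < A x) ->
  smooth F -> (forall x, 0 < F x) ->
  smooth dA -> smooth dN -> (forall x, 0 < dN x) ->
  exists N, [/\ smooth N, forall x, 0 < N x, forall x, x ord0 i3 = 0 -> N x = F x
    & forall x, logd i3 A x * dA x + logd i3 N x * dN x + 2 * pd i3 (P i3) x = 0].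
Proof.
move=> sA A0 sF F0 sdA sdN dN0.
pose m x := - ((logd i3 A x * dA x + 2 * pd i3 (P i3) x) * (dN x)^-1).
have sm : smooth m.
  apply: smooth_opp; apply: smooth_mul; last by apply: smooth_inv => // x; rewrite gt_eqF.
  apply: smooth_add; first by apply: smooth_mul => //; exact: smooth_logd.
  by apply: smooth_mul; [exact: smooth_cst|exact: smooth_pd].
have [N [sN NE N0 Np]] := transport_linear_exists i3 sm (smooth_cst 0) sF.
have {}Np := Np (fun=> erefl) F0.
exists N; split=> // x.
have -> : logd i3 N x = m x by rewrite /logd NE addr0 mulfK // gt_eqF.
by rewrite /m; have := dN0 x; move: (dN x) => d d0; field; rewrite gt_eqF.
Qed.

Lemma solve3 a A F : a = C11 \/ a = C22 -> smooth A -> (forall x, 0 < A x) ->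
  smooth F -> (forall x, 0 < F x) ->
  exists N, [/\ smooth N, forall x, 0 < N x, forall x, x ord0 i3 = 0 -> N x = F x
    & forall x, cube delta x ->
      eq3 P (if a is C11 then A else N) (if a is C11 then N else A) x = 0].
Proof.
move=> ha sA A0 sF F0; case: ha => ->.
- have [N [sN Np N0 NE]] := solve_diag sA A0 sF F0 s13 s23 d23_gt0.
  exists N; split=> // x xC; have [_ e13 e23] := gaps xC.
  by have := NE x; rewrite -e13 -e23 /eq3 => H; rewrite -oppr0 -H; ring.
- have [N [sN Np N0 NE]] := solve_diag sA A0 sF F0 s23 s13 d13_gt0.
  exists N; split=> // x xC; have [_ e13 e23] := gaps xC.
  by have := NE x; rewrite -e13 -e23 /eq3 => H; rewrite -oppr0 -H; ring.
Qed.

Let logsum l (C1 C2 C3 : 'rV[R]_3 -> R) x := logd l C1 x + logd l C2 x + logd l C3 x.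

Let smooth_logsum l C1 C2 C3 : smooth C1 -> smooth C2 -> smooth C3 ->
  (forall x, 0 < C1 x) -> (forall x, 0 < C2 x) -> (forall x, 0 < C3 x) ->
  smooth (logsum l C1 C2 C3).
Proof.
move=> sC1 sC2 sC3 C1p C2p C3p.
by apply: smooth_add; first apply: smooth_add; exact: smooth_logd.
Qed.

(** Common form of the equations for the kappa components; the factors -1/2 normalise the
    coefficient 2 of the derivative. *)
Let solve_kappa l (S q F : 'rV[R]_3 -> R) : smooth S -> smooth q -> smooth F ->
  exists N, [/\ smooth N, forall x, x ord0 l = 0 -> N x = F x
    & forall x, 2 * pd l N x + S x * N x + q x = 0].
Proof.
move=> sS sq sF.
have sS' : smooth (fun x => - 2^-1 * S x) by apply: smooth_mul => //; exact: smooth_cst.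
have sq' : smooth (fun x => - 2^-1 * q x) by apply: smooth_mul => //; exact: smooth_cst.
have [N [sN NE N0 _]] := transport_linear_exists l sS' sq' sF.
by exists N; split=> // x; rewrite NE; field.
Qed.

Lemma solve2 b (C1 C2 B F : 'rV[R]_3 -> R) : b = C33 \/ b = K23 ->
  smooth C1 -> smooth C2 -> (forall x, 0 < C1 x) -> (forall x, 0 < C2 x) ->
  smooth B -> (is_diag b -> forall x, 0 < B x) ->
  smooth F -> (is_diag (partner b) -> forall x, 0 < F x) ->
  exists N, [/\ smooth N, is_diag (partner b) -> forall x, 0 < N x,
    forall x, cube delta x -> x ord0 (evolution_dir (partner b)) = 0 -> N x = F x
    & forall x, cube delta x ->
      eq2 P C1 C2 (if b is C33 then B else N) (if b is C33 then N else B) x = 0].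
Proof.
move=> hb sC1 sC2 C1p C2p sB Bp sF Fp.
(* The part of the second constraint that contains neither c_33 nor kappa_2^3, shared by both
   cases. *)
pose r x := - (logd i2 C1 x * d12 x) - 2 * pd i2 (P i2) x.
have sr : smooth r.
  apply: smooth_sub.
    by apply: smooth_opp; apply: smooth_mul => //; exact: smooth_logd.
  by apply: smooth_mul; [exact: smooth_cst|exact: smooth_pd].
case: hb Bp Fp => -> /= Bp Fp.
- have {}Bp := Bp I.
  have sq : smooth (fun x => r x + logd i2 B x * d23 x).
    by apply: smooth_add => //; apply: smooth_mul => //; exact: smooth_logd.
  have [N [sN N0 NE]] := solve_kappa i3 (smooth_logsum i3 sC1 sC2 sB C1p C2p Bp) sq sF.
  exists N; split=> // [x _ x0|x xC]; first exact: N0.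
  have [e12 _ e23] := gaps xC; have := NE x.
  rewrite /eq2 /r /logsum -e12 -e23.
  move: (logd i2 C1 x) (logd i2 B x) (logd i3 C1 x) (logd i3 C2 x) (logd i3 B x).
  move: (P i1 x) (P i2 x) (P i3 x) (pd i2 (P i2) x) (pd i3 N x) (N x).
  by move=> p1 p2 p3 dp dN n L M L1 L2 L3 <-; ring.
- have {}Fp := Fp I.
  have sV : smooth (fun x => (d23 x)^-1) by apply: smooth_inv => // x; rewrite gt_eqF.
  (* Multiplying the constraint by c_33 and dividing by the gap p_3 - p_2 gives the transport
     equation with this velocity. The cutoff agrees with it on the cube, which is where the
     constraint has to hold. *)
  have sv : smooth (fun x => B x * (d23 x)^-1) by exact: smooth_mul.
  have [v [M [sv' vE vM dvM]]] := bounded_extension delta_gt0 i3 sv.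
  pose g x := - ((r x + 2 * pd i3 B x + (logd i3 C1 x + logd i3 C2 x) * B x) * (d23 x)^-1).
  have sg : smooth g.
    apply: smooth_opp; apply: smooth_mul => //; apply: smooth_add.
      apply: smooth_add => //; apply: smooth_mul; first exact: smooth_cst.
      exact: smooth_pd.
    by apply: smooth_mul => //; apply: smooth_add; exact: smooth_logd.
  have [N [sN NE N0 Np]] := transport sv' sg sF vM dvM.
  have {}Np := Np Fp; exists N; split=> // [x _ x0|x xC]; first exact: N0.
  have [e12 _ e23] := gaps xC; have := NE x; rewrite -vE // /g.
  rewrite /eq2 /r /logd -/(logd i2 C1 x) -/(logd i3 C1 x) -/(logd i3 C2 x).
  have -> : P i1 x - P i2 x = - d12 x by rewrite -e12 opprB.
  have -> : P i3 x - P i2 x = d23 x by [].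
  move: (d23_gt0 x) (Np x).
  move: (logd i2 C1 x) (logd i3 C1 x) (logd i3 C2 x) (pd i2 (P i2) x) (pd i3 B x) (B x).
  move: (pd i2 N x) (pd i3 N x) (N x) (d12 x) (d23 x).
  move=> n2 n3 n e d L L1 L2 dp dB k d0 n0 H.
  have dn0 : d != 0 by rewrite gt_eqF.
  have nn0 : n != 0 by rewrite gt_eqF.
  have -> : n2 = - ((- (L * e) - 2 * dp + 2 * dB + (L1 + L2) * k) * d^-1) * n - k / d * n3.
    by rewrite -H addrK.
  by field; rewrite dn0 nn0.
Qed.

Lemma solve1 (g : component) (C1 C2 C3 G F : 'rV[R]_3 -> R) : g = K12 \/ g = K13 ->
  smooth C1 -> smooth C2 -> smooth C3 ->
  (forall x, 0 < C1 x) -> (forall x, 0 < C2 x) -> (forall x, 0 < C3 x) ->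
  smooth G -> smooth F ->
  exists N, [/\ smooth N,
    forall x, x ord0 (evolution_dir (partner g)) = 0 -> N x = F x
    & forall x, cube delta x ->
      eq1 P C1 C2 C3 (if g is K12 then G else N) (if g is K12 then N else G) x = 0].
Proof.
move=> hg sC1 sC2 sC3 C1p C2p C3p sG sF.
pose r l x := logd i1 C2 x * d12 x + logd i1 C3 x * d13 x - 2 * pd i1 (P i1) x +
  2 * pd l G x + logsum l C1 C2 C3 x * G x.
have sS l := smooth_logsum l sC1 sC2 sC3 C1p C2p C3p.
have sr l : smooth (r l).
  apply: smooth_add; last exact: smooth_mul.
  apply: smooth_add; last by apply: smooth_mul; [exact: smooth_cst|exact: smooth_pd].
  apply: smooth_sub; last by apply: smooth_mul; [exact: smooth_cst|exact: smooth_pd].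
  by apply: smooth_add; apply: smooth_mul => //; exact: smooth_logd.
case: hg => -> /=.
- have [N [sN N0 NE]] := solve_kappa i3 (sS i3) (sr i2) sF.
  exists N; split=> // x xC; have [e12 e13 _] := gaps xC; have := NE x.
  rewrite /eq1 /r /logsum -e12 -e13.
  move: (logd i1 C2 x) (logd i1 C3 x) (logd i2 C1 x) (logd i2 C2 x) (logd i2 C3 x)
    (logd i3 C1 x) (logd i3 C2 x) (logd i3 C3 x).
  move: (P i1 x) (P i2 x) (P i3 x) (pd i1 (P i1) x) (pd i3 N x) (N x) (pd i2 G x) (G x).
  by move=> p1 p2 p3 dp dN n dk k a1 a2 b1 b2 b3 e1 e2 e3 <-; ring.
- have [N [sN N0 NE]] := solve_kappa i2 (sS i2) (sr i3) sF.
  exists N; split=> // x xC; have [e12 e13 _] := gaps xC; have := NE x.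
  rewrite /eq1 /r /logsum -e12 -e13.
  move: (logd i1 C2 x) (logd i1 C3 x) (logd i2 C1 x) (logd i2 C2 x) (logd i2 C3 x)
    (logd i3 C1 x) (logd i3 C2 x) (logd i3 C3 x).
  move: (P i1 x) (P i2 x) (P i3 x) (pd i1 (P i1) x) (pd i2 N x) (N x) (pd i3 G x) (G x).
  by move=> p1 p2 p3 dp dN n dk k a1 a2 b1 b2 b3 e1 e2 e3 <-; ring.
Qed.

End Existence.

(** * Uniqueness of the remaining three functions *)

Section Uniqueness.
Context {R : realType} (delta : R).
Hypothesis delta_gt0 : 0 < delta.
Variables (P : 'I_3 -> 'rV[R]_3 -> R) (d12 d13 d23 : 'rV[R]_3 -> R).
Hypothesis s23 : smooth d23.
Hypotheses (d13_gt0 : forall x, 0 < d13 x)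
  (d23_gt0 : forall x, 0 < d23 x).
Hypothesis gaps : forall x, cube delta x -> [/\ P i2 x - P i1 x = d12 x,
        P i3 x - P i1 x = d13 x & P i3 x - P i2 x = d23 x].
Implicit Types (V W : component -> 'rV[R]_3 -> R) (x : 'rV[R]_3).

Definition solution V : Prop :=
  [/\ forall u, smooth (V u), forall u, is_diag u -> forall x, 0 < V u x
    & forall x, cube delta x ->
      [/\ eq1 P (V C11) (V C22) (V C33) (V K12) (V K13) x = 0,
          eq2 P (V C11) (V C22) (V C33) (V K23) x = 0
        & eq3 P (V C11) (V C22) x = 0]].

(** An equation along an axis is a transport equation for a constant basis field, whose only inflow
    face is x_l = 0. The hypothesis compares the two sides directly, so a common source need not be
    named. *)
Let unique_along l (u u' mu : 'rV[R]_3 -> R) : smooth u -> smooth u' -> continuous mu ->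
  (forall x, cube delta x -> pd l u x - mu x * u x = pd l u' x - mu x * u' x) ->
  (forall x, cube delta x -> x ord0 l = 0 -> u x = u' x) -> eq_on_cube delta u u'.
Proof.
move=> su su' cmu E init.
have S (v : 'rV[R]_3 -> R) x : \sum_j (j == l)%:R * pd j v x = pd l v x.
  rewrite (bigD1 l) //= big1 => [|j /negbTE ->]; last by rewrite mul0r.
  by rewrite eqxx mul1r addr0.
apply: (@transport_unique _ _ delta delta_gt0 u u' (fun j _ => (j == l)%:R) mu
  (fun x => pd l u' x - mu x * u' x) l) => //.
- by move=> x _; rewrite eqxx.
- by move=> x xC; rewrite S -E // addrC subrK.
- by move=> x xC; rewrite S addrC subrK.
- move=> x j xC; case: eqVneq => [->|_] [[x0 ]|[x0]]; rewrite ?ltr0n ?ltr10 ?ltxx //.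
  by move=> _; exact: init.
Qed.

Let logd_eq l (f f' : 'rV[R]_3 -> R) x : smooth f -> smooth f' -> eq_on_cube delta f f' ->
  cube delta x -> logd l f x = logd l f' x.
Proof.
by move=> sf sf' ff' xC; rewrite /logd (pd_eq_on_cube delta_gt0 l sf sf') // ff'.
Qed.

(** Cancelling the known terms leaves equal logarithmic derivatives. Both functions then solve the
    linear equation whose coefficient is [logd i3 N']. *)
Let unique_diag (A A' N N' dA dN : 'rV[R]_3 -> R) :
  smooth A -> smooth A' -> smooth N -> smooth N' ->
  (forall x, 0 < N x) -> (forall x, 0 < N' x) -> (forall x, 0 < dN x) ->
  eq_on_cube delta A A' ->
  (forall x, cube delta x -> logd i3 A x * dA x + logd i3 N x * dN x =
     logd i3 A' x * dA x + logd i3 N' x * dN x) ->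
  (forall x, cube delta x -> x ord0 i3 = 0 -> N x = N' x) -> eq_on_cube delta N N'.
Proof.
move=> sA sA' sN sN' Np Np' dNp AA' E init.
apply: (@unique_along i3 N N' (logd i3 N')) => //.
  by apply: smooth_continuous; exact: smooth_logd.
move=> x xC; have := E x xC; rewrite (logd_eq i3 sA sA') // => /addrI.
move=> /(mulIf (lt0r_neq0 (dNp x))) e.
by rewrite -{1}e /logd !divfK ?subrr // gt_eqF.
Qed.

(** Each constraint is compared once the functions of the previous ones are known to agree. In
    [same_initial_data] the side faces enter for the unknown c_33, that is for b = K23, and then
    [V b] is indeed kappa_2^3. *)
Lemma solution_unique a b g V W :
  a = C11 \/ a = C22 -> b = C33 \/ b = K23 -> g = K12 \/ g = K13 ->
  solution V -> solution W ->
  (forall u, u = a \/ u = b \/ u = g -> eq_on_cube delta (V u) (W u)) ->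
  (forall u, u = partner a \/ u = partner b \/ u = partner g ->
     same_initial_data delta (V b) u (V u) (W u)) ->
  forall u, eq_on_cube delta (V u) (W u).
Proof.
move=> ha hb hg [sV Vp eV] [sW Wp eW] known init.
have lE l u : eq_on_cube delta (V u) (W u) ->
    forall x, cube delta x -> logd l (V u) x = logd l (W u) x.
  by move=> E x xC; apply: logd_eq.
have face u : u = partner a \/ u = partner b \/ u = partner g ->
    forall x, cube delta x -> x ord0 (evolution_dir u) = 0 -> V u x = W u x.
  by move=> hu x xC x0; apply: (init u hu); split=> //; left.
have [k11 k22] : eq_on_cube delta (V C11) (W C11) /\ eq_on_cube delta (V C22) (W C22).
  have Ea := known a (or_introl erefl); have Fa := face _ (or_introl erefl).
  case: ha Ea Fa => -> /= Ea Fa; split=> //.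
  - apply: (@unique_diag (V C11) (W C11) _ _ d13 d23) => //; [exact: Vp|exact: Wp|].
    move=> x xC; have [_ _ e] := eV x xC; have [_ _ e'] := eW x xC.
    have [_ <- <-] := gaps xC; move: e e'; rewrite /eq3 => e e'.
    lra.
  - apply: (@unique_diag (V C22) (W C22) _ _ d23 d13) => //; [exact: Vp|exact: Wp|].
    move=> x xC; have [_ _ e] := eV x xC; have [_ _ e'] := eW x xC.
    have [_ <- <-] := gaps xC; move: e e'; rewrite /eq3 => e e'.
    lra.
have [k33 k23] : eq_on_cube delta (V C33) (W C33) /\ eq_on_cube delta (V K23) (W K23).
  have Eb := known b (or_intror (or_introl erefl)).
  have Fb := init _ (or_intror (or_introl erefl)).
  case: hb Eb Fb => -> /= Eb Fb; split=> //.
  - pose S x := logd i3 (W C11) x + logd i3 (W C22) x + logd i3 (W C33) x.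
    apply: (@unique_along i3 _ _ (fun x => - 2^-1 * S x)) => //.
    + apply: smooth_continuous; apply: smooth_mul; first exact: smooth_cst.
      by apply: smooth_add; first apply: smooth_add; apply: smooth_logd => //; exact: Wp.
    + move=> x xC; have [_ e _] := eV x xC; have [_ e' _] := eW x xC.
      move: e e'; rewrite /eq2 !(lE _ C11) // !(lE _ C22) // !(lE _ C33) // -/(S x).
      move: (S x) (logd i2 (W C11) x) (logd i2 (W C33) x) (pd i2 (P i2) x)
        (P i1 x) (P i2 x) (P i3 x) (pd i3 (V K23) x) (pd i3 (W K23) x) (V K23 x) (W K23 x).
      by move=> s L M dp p1 p2 p3 dk dk' k k' e e'; lra.
    + by move=> x xC x0; apply: Fb; split=> //; left.
  (* The field is the characteristic direction normalised to have x_2-component 1. The coefficient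
     [mu] is read off from [W], so the equation for [W C33] is a tautology and that for [V C33]
     expresses the difference of the two constraints. *)
  - pose b' (j : 'I_3) x : R := if j == i2 then 1 else if j == i3 then V K23 x / d23 x else 0.
    pose mu x := logd i2 (W C33) x + V K23 x / d23 x * logd i3 (W C33) x.
    have sv : smooth (fun x => V K23 x / d23 x).
      by apply: smooth_mul => //; apply: smooth_inv => // x; rewrite gt_eqF.
    apply: (@transport_unique _ _ delta delta_gt0 _ _ b' mu (fun=> 0) i2) => //.
    + apply: smooth_continuous; apply: smooth_add; first by apply: smooth_logd => //; exact: Wp.
      by apply: smooth_mul => //; apply: smooth_logd => //; exact: Wp.
    + move=> x xC; rewrite sum_ord3 /b' /= mul0r add0r mul1r addr0 /mu.
      have [_ e _] := eV x xC; have [_ e' _] := eW x xC; have [_ _ g23] := gaps xC.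
      have := pd_eq_on_cube delta_gt0 i3 (sV K23) (sW K23) Eb xC.
      move: e e'; rewrite /eq2 -(Eb _ xC) !(lE _ C11) // !(lE _ C22) // g23 => e e' dK.
      rewrite -dK in e'.
      have H : logd i2 (V C33) x * d23 x + logd i3 (V C33) x * V K23 x =
          logd i2 (W C33) x * d23 x + logd i3 (W C33) x * V K23 x.
        move: e e'; move: (logd i2 (W C11) x) (logd i3 (W C11) x) (logd i3 (W C22) x)
          (logd i2 (V C33) x) (logd i2 (W C33) x) (logd i3 (V C33) x) (logd i3 (W C33) x)
          (V K23 x) (d23 x) (pd i2 (P i2) x) (P i1 x) (P i2 x) (pd i3 (V K23) x).
        by move=> *; lra.
      have v0 : 0 < V C33 x by exact: Vp.
      have -> : pd i2 (V C33) x = logd i2 (V C33) x * V C33 x by rewrite /logd divfK ?gt_eqF.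
      have -> : pd i3 (V C33) x = logd i3 (V C33) x * V C33 x by rewrite /logd divfK ?gt_eqF.
      move: H (d23_gt0 x); move: (logd i2 (V C33) x) (logd i2 (W C33) x)
        (logd i3 (V C33) x) (logd i3 (W C33) x) (V K23 x) (d23 x) (V C33 x).
      move=> a2 a2' a3 a3' k d c H d0; have dn0 : d != 0 by rewrite gt_eqF.
      have -> : a2 = (a2' * d + a3' * k - a3 * k) / d by rewrite -H addrK mulfK.
      by field.
    + move=> x xC; rewrite sum_ord3 /b' /= mul0r add0r mul1r addr0 /mu.
      have w0 : 0 < W C33 x by exact: Wp.
      rewrite /logd; move: (pd i2 (W C33) x) (pd i3 (W C33) x) (V K23 x / d23 x) (W C33 x) w0.
      by move=> u v k c c0; field; rewrite gt_eqF.
    (* The field has no x_1-component and points forward in x_2. Its x_3-component has the sign of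
       kappa_2^3 because [d23] is positive, so its inflow points are those of [inflow_boundary]. *)
    + move=> x j xC H; apply: Fb; split=> //; move: j H; rewrite /b'; apply: ord3P => /=.
      * by rewrite !ltxx => -[[]|[]].
      * by rewrite ltr10 => -[[x0 _]|[]] //; left.
      * rewrite pmulr_lgt0 ?invr_gt0 // pmulr_llt0 ?invr_gt0 // => H.
        by right; split.
have [k12 k13] : eq_on_cube delta (V K12) (W K12) /\ eq_on_cube delta (V K13) (W K13).
  have Eg := known g (or_intror (or_intror erefl)).
  have Fg := face _ (or_intror (or_intror erefl)).
  pose S l x := logd l (W C11) x + logd l (W C22) x + logd l (W C33) x.
  have cS l : continuous (fun x => - 2^-1 * S l x).
    apply: smooth_continuous; apply: smooth_mul; first exact: smooth_cst.
    by apply: smooth_add; first apply: smooth_add; apply: smooth_logd => //; exact: Wp.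
  have E x : cube delta x ->
      2 * pd i2 (V K12) x + S i2 x * V K12 x + 2 * pd i3 (V K13) x + S i3 x * V K13 x =
      2 * pd i2 (W K12) x + S i2 x * W K12 x + 2 * pd i3 (W K13) x + S i3 x * W K13 x.
    move=> xC; have [e _ _] := eV x xC; have [e' _ _] := eW x xC.
    move: e e'; rewrite /S /eq1 !(lE _ C11) // !(lE _ C22) // !(lE _ C33) //.
    move: (logd i2 (W C11) x) (logd i2 (W C22) x) (logd i2 (W C33) x)
      (logd i3 (W C11) x) (logd i3 (W C22) x) (logd i3 (W C33) x)
      (logd i1 (W C22) x) (logd i1 (W C33) x) (pd i1 (P i1) x)
      (P i1 x) (P i2 x) (P i3 x) (pd i2 (V K12) x) (pd i2 (W K12) x) (V K12 x) (W K12 x)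
      (pd i3 (V K13) x) (pd i3 (W K13) x) (V K13 x) (W K13 x).
    by move=> *; lra.
  case: hg Eg Fg => -> /= Eg Fg; split=> //.
  - apply: (@unique_along i3 _ _ (fun x => - 2^-1 * S i3 x)) => // x xC.
    have := E x xC; rewrite (pd_eq_on_cube delta_gt0 i2 (sV K12) (sW K12) Eg xC) (Eg _ xC).
    move: (S i2 x) (S i3 x) (pd i2 (W K12) x) (W K12 x) (pd i3 (V K13) x)
      (pd i3 (W K13) x) (V K13 x) (W K13 x).
    by move=> *; lra.
  - apply: (@unique_along i2 _ _ (fun x => - 2^-1 * S i2 x)) => // x xC.
    have := E x xC; rewrite (pd_eq_on_cube delta_gt0 i3 (sV K13) (sW K13) Eg xC) (Eg _ xC).
    move: (S i2 x) (S i3 x) (pd i3 (W K13) x) (W K13 x) (pd i2 (V K12) x)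
      (pd i2 (W K12) x) (V K12 x) (W K12 x).
    by move=> *; lra.
by case.
Qed.

End Uniqueness.

(** * Between vacuum data and solutions of the constraints *)

Section Assembly.
Context {R : realType} (delta : R).
Hypothesis delta_gt0 : 0 < delta.
Implicit Types (p P : 'I_3 -> 'rV[R]_3 -> R) (c : 'I_3 -> 'I_3 -> 'rV[R]_3 -> R).

(** Sorts prescribed and unknown functions into the six named slots, so that existence and
    uniqueness can be argued on one family indexed by [component] for all eight choices of [a], [b],
    [g]. *)
Definition assemble (a b g : component)
    (alpha beta gamma eps zeta eta : 'rV[R]_3 -> R) (u : component) : 'rV[R]_3 -> R :=
  match u with
  | C11 => if a is C11 then alpha else eps
  | C22 => if a is C11 then eps else alpha
  | C33 => if b is C33 then beta else zeta
  | K23 => if b is C33 then zeta else beta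
  | K12 => if g is K12 then gamma else eta
  | K13 => if g is K12 then eta else gamma
  end.

Section Names.
Variables (a b g : component).
Hypotheses (ha : a = C11 \/ a = C22) (hb : b = C33 \/ b = K23) (hg : g = K12 \/ g = K13).

Lemma realizesP p c (alpha beta gamma eps zeta eta : 'rV[R]_3 -> R) :
  realizes delta p c a b g alpha beta gamma eps zeta eta <->
  forall u, eq_on_cube delta (component_val p c u)
    (assemble a b g alpha beta gamma eps zeta eta u).
Proof.
split=> [[[r1 r2 r3] [r4 r5 r6]] u|H].
  move: r1 r2 r3 r4 r5 r6; case: ha => ->; case: hb => ->; case: hg => ->;
    by case: u => /=.
case: ha H => ->; case: hb => ->; case: hg => -> H; split; split;
  by [exact: (H C11)|exact: (H C22)|exact: (H C33)|exact: (H K12)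
     |exact: (H K13)|exact: (H K23)].
Qed.

Lemma assemble_ind (Q : component -> ('rV[R]_3 -> R) -> Prop)
    (alpha beta gamma eps zeta eta : 'rV[R]_3 -> R) :
  Q a alpha -> Q b beta -> Q g gamma ->
  Q (partner a) eps -> Q (partner b) zeta -> Q (partner g) eta ->
  forall u, Q u (assemble a b g alpha beta gamma eps zeta eta u).
Proof.
by case: ha => ->; case: hb => ->; case: hg => -> /= q1 q2 q3 q4 q5 q6; case.
Qed.

End Names.

(** Treats metric components, which must stay positive off the cube, and kappa components, which
    carry no sign, uniformly. *)
Lemma diag_extension n (u : component) (f : 'rV[R]_n.+1 -> R) :
  smooth_on_cube delta f -> positive_if_diag delta u f ->
  exists F, [/\ smooth F, is_diag u -> forall x, 0 < F x & eq_on_cube delta f F].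
Proof.
move=> sf fp; case: (pselect (is_diag u)) => du.
  have [F [sF Fp fF]] := positive_extension delta_gt0 sf (fp du).
  by exists F; split.
by case: sf => F sF fF; exists F; split.
Qed.

Lemma diag_initial_extension (u : component) (l : 'I_3) (f : 'rV[R]_2 -> R) :
  smooth_on_cube delta f -> positive_if_diag delta u f ->
  exists F, [/\ smooth F, is_diag u -> forall x, 0 < F x
    & forall x, cube delta x -> F x = f (col' l x)].
Proof.
move=> sf fp; case: (pselect (is_diag u)) => du.
  have [F [sF Fp fF]] := positive_initial_extension delta_gt0 l sf (fp du).
  by exists F; split.
by have [F sF fF] := initial_extension l sf; exists F; split.
Qed.

Lemma vacuum_data_of_solution p P V : kasner delta p ->
  (forall i, smooth (P i)) -> (forall i, eq_on_cube delta (p i) (P i)) ->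
  solution delta P V ->
  exists c, vacuum_data delta p c /\
    forall u, eq_on_cube delta (component_val p c u) (V u).
Proof.
move=> kp sP pP [sV Vp eqs].
have [c [sc symc [c1 c2 c3] [k12 k13 k23]]] := metric_of_components delta_gt0 kp sP pP
  (sV C11) (sV C22) (sV C33) (sV K12) (sV K13) (sV K23)
  (Vp C11 I) (Vp C22 I) (Vp C33 I).
have cV u : eq_on_cube delta (component_val p c u) (V u).
  by case: u => /=; rewrite ?c1 ?c2 ?c3.
exists c; split=> //; split.
- split=> [i|i j]; first by exists (P i); [exact: sP|exact: pP].
  by exists (c i j).
- split; last by move=> i j x _; rewrite symc.
  by apply: ord3P => x _; rewrite ?c1 ?c2 ?c3; exact: Vp.
- exact: kp.
- have pos u : is_diag u -> forall x, cube delta x -> 0 < V u x.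
    by move=> du x _; exact: Vp.
  move=> i x xC; have [e1 e2 e3] := eqs x xC.
  move: i; apply: ord3P.
  + by rewrite -e1; apply: (constraint1 delta_gt0 sP pP
      (sV C11) (sV C22) (sV C33) (sV K12) (sV K13)
      (pos C11 I) (pos C22 I) (pos C33 I) (cV C11) (cV C22) (cV C33) (cV K12) (cV K13)).
  + by rewrite -e2; apply: (constraint2 delta_gt0 sP pP
      (sV C11) (sV C22) (sV C33) (sV K23)
      (pos C11 I) (pos C22 I) (pos C33 I) (cV C11) (cV C22) (cV C33) (cV K23)).
  + by rewrite -e3; apply: (constraint3 delta_gt0 sP pP
      (sV C11) (sV C22) (sV C33) (cV C11) (cV C22) (cV C33)).
Qed.

(** Representatives are chosen component by component, positive for the diagonal ones. The
    constraints transfer because they depend only on the restrictions to the cube. *)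
Lemma solution_of_vacuum_data p P c :
  (forall i, smooth (P i)) -> (forall i, eq_on_cube delta (p i) (P i)) ->
  vacuum_data delta p c ->
  (forall u, smooth_on_cube delta (component_val p c u)) ->
  exists V, solution delta P V /\
    forall u, eq_on_cube delta (component_val p c u) (V u).
Proof.
move=> sP pP [[sp sc] [cp symc] kp con] su.
have pos u : positive_if_diag delta u (component_val p c u).
  by case: u => //= _ x; exact: cp.
have [V HV] := choice (fun u => diag_extension (su u) (@pos u)).
have sV u : smooth (V u) by have [] := HV u.
have Vp u : is_diag u -> forall x, 0 < V u x by have [] := HV u.
have cV u : eq_on_cube delta (component_val p c u) (V u) by have [] := HV u.
exists V; split=> //; split=> // x xC.
have pos' u : is_diag u -> forall x, cube delta x -> 0 < V u x.
  by move=> du y _; exact: Vp.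
split.
- rewrite -(con i1 x xC); apply/esym; apply: (constraint1 delta_gt0 sP pP
      (sV C11) (sV C22) (sV C33) (sV K12) (sV K13)
      (pos' C11 I) (pos' C22 I) (pos' C33 I) (cV C11) (cV C22) (cV C33) (cV K12) (cV K13) xC).
- rewrite -(con i2 x xC); apply/esym; apply: (constraint2 delta_gt0 sP pP
      (sV C11) (sV C22) (sV C33) (sV K23)
      (pos' C11 I) (pos' C22 I) (pos' C33 I) (cV C11) (cV C22) (cV C33) (cV K23) xC).
- rewrite -(con i3 x xC); apply/esym; apply: (constraint3 delta_gt0 sP pP
      (sV C11) (sV C22) (sV C33) (cV C11) (cV C22) (cV C33) xC).
Qed.

End Assembly.

Theorem proposition2p1 (R : realType) (delta : R) (delta_gt0 : 0 < delta)
    (p : 'I_3 -> 'rV[R]_3 -> R)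
    (p_smooth : forall i, smooth_on_cube delta (p i))
    (p_kasner : kasner delta p)
    (a b g : component)
    (ha : a = C11 \/ a = C22) (hb : b = C33 \/ b = K23)
    (hg : g = K12 \/ g = K13)
    (alpha beta gamma : 'rV[R]_3 -> R)
    (alpha_smooth : smooth_on_cube delta alpha)
    (beta_smooth : smooth_on_cube delta beta)
    (gamma_smooth : smooth_on_cube delta gamma)
    (alpha_pos : positive_if_diag delta a alpha)
    (beta_pos : positive_if_diag delta b beta) :
  [/\ exists eps zeta eta : 'rV[R]_3 -> R,
        completes delta p a b g alpha beta gamma eps zeta eta,
      forall f1 f2 f3 : 'rV[R]_2 -> R,
        smooth_on_cube delta f1 -> smooth_on_cube delta f2 ->
        smooth_on_cube delta f3 ->
        positive_if_diag delta (partner a) f1 ->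
        positive_if_diag delta (partner b) f2 ->
        exists eps zeta eta : 'rV[R]_3 -> R,
          completes delta p a b g alpha beta gamma eps zeta eta /\
          [/\ has_initial_value delta (partner a) eps f1,
              has_initial_value delta (partner b) zeta f2
            & has_initial_value delta (partner g) eta f3]
    & forall eps zeta eta eps' zeta' eta' : 'rV[R]_3 -> R,
        completes delta p a b g alpha beta gamma eps zeta eta ->
        completes delta p a b g alpha beta gamma eps' zeta' eta' ->
        same_initial_data delta beta (partner a) eps eps' ->
        same_initial_data delta beta (partner b) zeta zeta' ->
        same_initial_data delta beta (partner g) eta eta' ->
        [/\ eq_on_cube delta eps eps', eq_on_cube delta zeta zeta'
          & eq_on_cube delta eta eta']].
Proof.
have [P HP] : exists P : 'I_3 -> 'rV[R]_3 -> R, forall i,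
    smooth (P i) /\ eq_on_cube delta (p i) (P i).
  suff /choice[P HP] : forall i, exists Pi : 'rV[R]_3 -> R,
    smooth Pi /\ eq_on_cube delta (p i) Pi by exists P.
  by move=> i; case: (p_smooth i) => Pi; exists Pi.
have sP i := (HP i).1; have pP i := (HP i).2.
have [d12 [d13 [d23 [[s12 s13 s23] [d12p d13p d23p] gaps]]]] :=
  kasner_gaps delta_gt0 p_kasner sP pP.
have da : is_diag a by case: ha => ->.
have dpa : is_diag (partner a) by case: ha => ->.
have exist (f1 f2 f3 : 'rV[R]_2 -> R) :
    smooth_on_cube delta f1 -> smooth_on_cube delta f2 -> smooth_on_cube delta f3 ->
    positive_if_diag delta (partner a) f1 -> positive_if_diag delta (partner b) f2 ->
    exists eps zeta eta : 'rV[R]_3 -> R,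
      completes delta p a b g alpha beta gamma eps zeta eta /\
      [/\ has_initial_value delta (partner a) eps f1,
          has_initial_value delta (partner b) zeta f2
        & has_initial_value delta (partner g) eta f3].
  move=> sf1 sf2 sf3 p1 p2.
  have [A [sA Ap EA]] := diag_extension delta_gt0 alpha_smooth alpha_pos.
  have [B [sB Bp EB]] := diag_extension delta_gt0 beta_smooth beta_pos.
  have [G sG EG] := gamma_smooth.
  have [F1 [sF1 F1p F1E]] := diag_initial_extension delta_gt0 (evolution_dir (partner a)) sf1 p1.
  have [F2 [sF2 F2p F2E]] := diag_initial_extension delta_gt0 (evolution_dir (partner b)) sf2 p2.
  have [F3 sF3 F3E] := initial_extension (evolution_dir (partner g)) sf3.
  have [N1 [sN1 N1p N10 e3]] := solve3 sP s13 s23 d13p d23p gaps ha sA (Ap da) sF1 (F1p dpa).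
  pose C1 := if a is C11 then A else N1; pose C2 := if a is C11 then N1 else A.
  have [sC1 C1p] : smooth C1 /\ forall x, 0 < C1 x.
    by rewrite /C1; case: (a); split=> //; exact: Ap.
  have [sC2 C2p] : smooth C2 /\ forall x, 0 < C2 x.
    by rewrite /C2; case: (a); split=> //; exact: Ap.
  have [N2 [sN2 N2p N20 e2]] := solve2 delta_gt0 sP s12 s23 d23p gaps hb
    sC1 sC2 C1p C2p sB Bp sF2 F2p.
  pose C3 := if b is C33 then B else N2.
  have [sC3 C3p] : smooth C3 /\ forall x, 0 < C3 x.
    by case: hb Bp N2p => + Bp N2p; rewrite /C3 => eb; rewrite eb in Bp N2p *;
      split=> //; [exact: Bp|exact: N2p].
  have [N3 [sN3 N30 e1]] := solve1 sP s12 s13 gaps hg sC1 sC2 sC3 C1p C2p C3p sG sF3.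
  pose V := assemble a b g A B G N1 N2 N3.
  have Vsol : solution delta P V.
    split.
    - exact: (assemble_ind ha hb hg (Q := fun _ f => smooth f)).
    - apply: (assemble_ind ha hb hg (Q := fun u f => is_diag u -> forall x, 0 < f x)) => //.
        by case: hg => ->.
      by case: hg => ->.
    - by move=> x xC; split; [exact: e1|exact: e2|exact: e3].
  have [c [cv cV]] := vacuum_data_of_solution delta_gt0 p_kasner sP pP Vsol.
  (* The solution was built from extensions [A], [B], [G] of the prescribed functions, which agree
     with [alpha], [beta], [gamma] on the cube only. *)
  have VE u : eq_on_cube delta (V u) (assemble a b g alpha beta gamma N1 N2 N3 u).
    move=> x xC; rewrite /V.
    by case: u => /=; [case: (a)|case: (a)|case: (b)|case: (g)|case: (g)|case: (b)];
      rewrite ?EA ?EB ?EG.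
  have cE u : eq_on_cube delta (component_val p c u)
      (assemble a b g alpha beta gamma N1 N2 N3 u).
    by move=> x xC; rewrite cV // VE.
  exists N1, N2, N3; split; last split.
  - split; [by exists N1|by exists N2|by exists N3|exists c; split=> //].
      exact/realizesP.
    move=> c' symc' /(realizesP delta ha hb hg) c'E.
    have [_ [cp symc] _ _] := cv.
    by apply: (metric_unique p_kasner symc symc' cp) => u x xC; rewrite c'E // cE.
  - move=> x xC x0; rewrite N10 ?F1E //.
    by move: x0; case: ha => ->.
  - by move=> x xC x0; rewrite N20 ?F2E.
  - by move=> x xC x0; rewrite N30 ?F3E.
split.
(* The first claim is the second with all initial data equal to 1, a choice that is positive for the
   diagonal components. *)
- have s1 : smooth_on_cube delta (fun _ : 'rV[R]_2 => 1 : R).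
    by exists (fun=> 1) => //; exact: smooth_cst.
  have [||eps [zeta [eta [H _]]]] := exist _ _ _ s1 s1 s1; try by move=> _ y _; exact: ltr01.
  by exists eps, zeta, eta.
- exact: exist.
- move=> eps zeta eta eps' zeta' eta' [s1 s2 s3 [c [cv cr _]]] [s1' s2' s3' [c' [cv' cr' _]]].
  move=> Ia Ib Ig.
  have {cr} cE := (realizesP delta ha hb hg _ _ _ _ _ _ _ _).1 cr.
  have {cr'} cE' := (realizesP delta ha hb hg _ _ _ _ _ _ _ _).1 cr'.
  have smooth_val c0 (e z t : 'rV[R]_3 -> R) :
      smooth_on_cube delta e -> smooth_on_cube delta z -> smooth_on_cube delta t ->
      (forall u, eq_on_cube delta (component_val p c0 u)
        (assemble a b g alpha beta gamma e z t u)) ->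
      forall u, smooth_on_cube delta (component_val p c0 u).
    move=> se sz st E u.
    have [F sF FE] : smooth_on_cube delta (assemble a b g alpha beta gamma e z t u).
      exact: (assemble_ind ha hb hg (Q := fun _ f => smooth_on_cube delta f)).
    by exists F => // x xC; rewrite E // FE.
  have [V [Vsol cV]] := solution_of_vacuum_data delta_gt0 sP pP cv
    (smooth_val _ _ _ _ s1 s2 s3 cE).
  have [W [Wsol cW]] := solution_of_vacuum_data delta_gt0 sP pP cv'
    (smooth_val _ _ _ _ s1' s2' s3' cE').
  have VE u : eq_on_cube delta (V u) (assemble a b g alpha beta gamma eps zeta eta u).
    by move=> x xC; rewrite -cV // cE.
  have WE u : eq_on_cube delta (W u) (assemble a b g alpha beta gamma eps' zeta' eta' u).
    by move=> x xC; rewrite -cW // cE'.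
  have aE (al be ga e z t : 'rV[R]_3 -> R) :
    [/\ assemble a b g al be ga e z t a = al, assemble a b g al be ga e z t b = be
      & assemble a b g al be ga e z t g = ga] /\
    [/\ assemble a b g al be ga e z t (partner a) = e,
        assemble a b g al be ga e z t (partner b) = z
      & assemble a b g al be ga e z t (partner g) = t].
    by case: ha => ->; case: hb => ->; case: hg => ->.
  have [[a1 a2 a3] [a4 a5 a6]] := aE alpha beta gamma eps zeta eta.
  have [[b1 b2 b3] [b4 b5 b6]] := aE alpha beta gamma eps' zeta' eta'.
  have key : forall u, eq_on_cube delta (V u) (W u).
    apply: (solution_unique delta_gt0 s23 d13p d23p gaps ha hb hg Vsol Wsol).
      move=> u hu x xC; rewrite VE // WE //.
      by case: hu => [->|[->|->]]; rewrite ?a1 ?a2 ?a3 ?b1 ?b2 ?b3.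
    move=> u hu x [xC xin]; rewrite VE // WE //.
    (* The inflow boundary lies in the cube, where the representative [V b] coincides with [beta],
       so both describe the same set. *)
    have xin' : inflow_boundary delta beta u x.
      by split=> //; move: xin; rewrite VE // a2.
    by case: hu xin' => [->|[->|->]] xin'; rewrite ?a4 ?a5 ?a6 ?b4 ?b5 ?b6;
      [exact: Ia|exact: Ib|exact: Ig].
  split=> x xC.
  - by have := key (partner a) x xC; rewrite VE // WE // a4 b4.
  - by have := key (partner b) x xC; rewrite VE // WE // a5 b5.
  - by have := key (partner g) x xC; rewrite VE // WE // a6 b6.
Qed.
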